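(* (Fundamental theorem of loop symmetric functions.) The loop elementary symmetric functions $e_k^{(r)}$ ($k \in [m]$, $r \in [n]$) generate the ring ${\rm Inv}_R \cap \mathbb{C}[x_i^j]$ of polynomial invariants of the geometric $R$-matrices $R_1,\dots,R_{m-1}$.
   Context: Let $x_i^j$, $i \in [m]$, $j \in [n]$, be indeterminates, reindexed as $x_i^{(r)}$ with superscript $r$ taken modulo $n$ via $x_i^j = x_i^{(j+i-1)}$, so row $i$ is $\mathbf{x}_i = (x_i^{(i)}, x_i^{(i+1)},\dots,x_i^{(i+n-1)})$. For $k \in [m]$ and $r \in [n]$, the loop elementary symmetric function is $e_k^{(r)} = \sum_{1 \le i_1 < i_2 < \cdots < i_k \le m} x_{i_1}^{(r)} x_{i_2}^{(r+1)} \cdots x_{i_k}^{(r+k-1)}$. The geometric $R$-matrix is the rational map $R\bigl((x_1,\dots,x_n),(y_1,\dots,y_n)\bigr) = \bigl((y'_1,\dots,y'_n),(x'_1,\dots,x'_n)\bigr)$ with $y'_j = y_j \kappa_{j+1}/\kappa_j$, $x'_j = x_j \kappa_j/\kappa_{j+1}$, $\kappa_r = \sum_{k=0}^{n-1} y_r\cdots y_{r+k-1} x_{r+k+1}\cdots x_{r+n-1}$ (subscripts mod $n$). For $i \in [m-1]$, $R_i$ replaces the pair of rows $(\mathbf{x}_i,\mathbf{x}_{i+1})$ of the $m \times n$ matrix $(x_i^j)$ (rows $\mathbf{x}_i = (x_i^1,\dots,x_i^n)$) by $(\mathbf{x}'_{i+1},\mathbf{x}'_i) = R(\mathbf{x}_i,\mathbf{x}_{i+1})$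 and fixes the other rows. ${\rm Inv}_R \subset \mathbb{C}(x_i^j)$ is the field of rational functions fixed by all $R_i$. *)

(* Defs.v *)
From HB Require Import structures.
From mathcomp Require Import all_boot all_algebra.
From mathcomp Require Import Rstruct.
From mathcomp.real_closed Require Import complex.
From mathcomp Require Import mpoly.

Set Implicit Arguments.
Unset Strict Implicit.
Unset Printing Implicit Defensive.
Import GRing.Theory.
Local Open Scope ring_scope.

Definition Cplx : fieldType := Rdefinitions.R[i].

(* Indices are 0-based: row i : 'I_m stands for row i+1 of the paper,
   column j : 'I_n for column j+1.  The variables x_i^j are indexed by
   the finite type 'I_m * 'I_n, via enum_rank. *)
Definition nvars (m n : nat) : nat := #|{: 'I_m * 'I_n}|.

Definition polyring (m n : nat) := {mpoly Cplx[nvars m n]}.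

Definition xv (m n : nat) (i : 'I_m) (j : 'I_n) : {mpoly Cplx[nvars m n]} :=
  'X_(enum_rank (i, j)).

Definition shiftI (n : nat) (j : 'I_n) (t : nat) : 'I_n := insubd j ((j + t) %% n)%N.

(* the reindexed variable x_{i+1}^{(r+1)} = x_{i+1}^{j+1} with j = r - i mod n
   (paper, 1-based: x_i^j = x_i^{(j+i-1)}). *)
Definition xloop (m n : nat) (i : 'I_m) (r : 'I_n) : {mpoly Cplx[nvars m n]} :=
  xv i (insubd r ((r + (n - i %% n)) %% n)%N).

(* loop elementary symmetric function e_{k}^{(r+1)}, for k in [m] (1-based k)
   and r : 'I_n:  sum over i_1 < ... < i_k of
   x_{i_1}^{(r)} x_{i_2}^{(r+1)} ... x_{i_k}^{(r+k-1)}.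
   A k-subset S of rows is listed increasingly by enum S; the element i of S
   at position t = index i (enum S) gets superscript r + t. *)
Definition loop_e (m n : nat) (k : nat) (r : 'I_n) : {mpoly Cplx[nvars m n]} :=
  \sum_(S : {set 'I_m} | #|S| == k)
     \prod_(i <- enum S) xloop i (shiftI r (index i (enum S))).

Definition ratfun (m n : nat) := {fraction {mpoly Cplx[nvars m n]}}.

Definition frac_of (m n : nat) (p : {mpoly Cplx[nvars m n]}) : ratfun m n :=
  @FracField.tofrac _ p.

Definition xf (m n : nat) (i : 'I_m) (j : 'I_n) : ratfun m n := frac_of (xv i j).

Definition kappa (F : comNzRingType) (n : nat) (x y : 'I_n -> F) (r : 'I_n) : F :=
  \sum_(k < n) ((\prod_(t < n | (t < k)%N) y (shiftI r t)) *
                (\prod_(t < n | (k < t)%N) x (shiftI r t))).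

Definition Rmat_y' (F : fieldType) (n : nat) (x y : 'I_n -> F) (j : 'I_n) : F :=
  y j * kappa x y (shiftI j 1) / kappa x y j.
Definition Rmat_x' (F : fieldType) (n : nat) (x y : 'I_n -> F) (j : 'I_n) : F :=
  x j * kappa x y j / kappa x y (shiftI j 1).

(* R_i (i : nat, 0-based, acting on rows i and i+1 with i.+1 < m) as a
   substitution of rational functions for the variables: row i is replaced
   by y' and row i+1 by x', where (x, y) = (row i, row i+1). *)
Definition Ri_subst (m n : nat) (i : nat) (a : 'I_m * 'I_n) : ratfun m n :=
  let x := fun j : 'I_n => [fun b : 'I_m => xf b j] (insubd a.1 i) in
  let y := fun j : 'I_n => [fun b : 'I_m => xf b j] (insubd a.1 i.+1) in
  if val a.1 == i then Rmat_y' x y a.2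
  else if val a.1 == i.+1 then Rmat_x' x y a.2
  else xf a.1 a.2.

Definition Ri_act (m n : nat) (i : nat) (p : {mpoly Cplx[nvars m n]}) : ratfun m n :=
  mmap (fun c : Cplx => frac_of (c%:MP : {mpoly Cplx[nvars m n]}))
       (fun v : 'I_(nvars m n) => Ri_subst i (enum_val v)) p.

Definition R_invariant (m n : nat) (p : {mpoly Cplx[nvars m n]}) : Prop :=
  forall i : nat, (i.+1 < m)%N -> Ri_act i p = frac_of p.

Definition in_loop_sym_algebra (m n : nat) (p : {mpoly Cplx[nvars m n]}) : Prop :=
  exists q : {mpoly Cplx[nvars m n]},
    p = mmap (fun c : Cplx => c%:MP)
             (fun v : 'I_(nvars m n) =>
                let kr := enum_val v in loop_e m kr.1.+1 kr.2) q.

(* Main.v *)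
(** The argument follows the classical one for symmetric polynomials.  In the
    graded lexicographic order (first row largest) the leading monomial of
    e_{k+1}^{(r)} is the product of the x_i^r over the first k+1 rows, so it suffices that the
    leading monomial of an invariant p has, in each column r, an exponent of
    x_i^r at least that of x_{i+1}^r; one then subtracts a monomial in the
    loop elementary symmetric functions and inducts.

    For two adjacent rows (x, y) and a column r, move (x, y) along the rational
    curve (x(q), y(q)) on which all x_j y_j and all x_{j+1} + y_j except
    x_r + y_{r-1} are constant.  There R acts by q -> 1/(A q), where A is the
    product of the x_j divided by that of the y_j, and apart from 0 and oo this
    involution carries no pole of q |-> p to a pole.  Hence p is a Laurent
    polynomial sum_k g_k q^k with g_{-k} = A^{-k} g_k.  Over C(eps), start from
    the point whose entries are eps^{-weight}, for weights representing the
    monomial order on the support of p: as eps -> 0 the leading monomial of p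
    dominates and its dependence on q is q^{a-b}, where a and b are the exponents
    of x_r and y_r.  Since A^{-1} -> 0, the symmetry of the g_k excludes a < b. *)
Require Import Defs.
From HB Require Import structures.
From mathcomp Require Import all_boot all_order all_algebra.
From mathcomp Require Import Rstruct.
From mathcomp.real_closed Require Import complex.
From mathcomp Require Import mpoly.
From mathcomp Require Import ring zify.

Set Implicit Arguments.
Unset Strict Implicit.
Unset Printing Implicit Defensive.
Import Order.TTheory GRing.Theory.
Local Open Scope ring_scope.

(** * Specialization of fractions *)

Section Specialization.
Variables (R : idomainType) (L : fieldType) (ev : {rmorphism R -> L}).
Local Notation tofrac := (@FracField.tofrac R).
Implicit Types (z : {fraction R}) (c : L).

(* [z] is regular at the point [ev], with value [c]. *)
Definition specializes z c : Prop :=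
  exists n d : R, [/\ ev d != 0, z * tofrac d = tofrac n & c * ev d = ev n].

Lemma specializes_inj z c c' : specializes z c -> specializes z c' -> c = c'.
Proof.
move=> [n [d [d0 zd cd]]] [n' [d' [d'0 zd' cd']]].
have nd : n * d' = n' * d.
  by apply/eqP; rewrite -tofrac_eq !tofracM -zd -zd'; apply/eqP; ring.
have := congr1 ev nd; rewrite !rmorphM -cd -cd' => e.
by apply: (mulIf d0); apply: (mulIf d'0); rewrite e; ring.
Qed.

Lemma specializes_tofrac p : specializes (tofrac p) (ev p).
Proof. by exists p, 1; rewrite !rmorph1 !mulr1 oner_neq0. Qed.

Lemma specializes0 : specializes 0 0.
Proof. by have := specializes_tofrac 0; rewrite tofrac0 rmorph0. Qed.

Lemma specializes1 : specializes 1 1.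
Proof. by have := specializes_tofrac 1; rewrite tofrac1 rmorph1. Qed.

Lemma specializesD z z' c c' :
  specializes z c -> specializes z' c' -> specializes (z + z') (c + c').
Proof.
move=> [n [d [d0 zd cd]]] [n' [d' [d'0 zd' cd']]].
exists (n * d' + n' * d), (d * d'); split.
- by rewrite rmorphM mulf_neq0.
- by rewrite tofracD !tofracM -zd -zd'; ring.
- by rewrite rmorphD !rmorphM -cd -cd'; ring.
Qed.

Lemma specializesM z z' c c' :
  specializes z c -> specializes z' c' -> specializes (z * z') (c * c').
Proof.
move=> [n [d [d0 zd cd]]] [n' [d' [d'0 zd' cd']]].
exists (n * n'), (d * d'); split.
- by rewrite rmorphM mulf_neq0.
- by rewrite !tofracM -zd -zd'; ring.
- by rewrite !rmorphM -cd -cd'; ring.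
Qed.

Lemma specializesB z z' c c' :
  specializes z c -> specializes z' c' -> specializes (z - z') (c - c').
Proof.
move=> zc zc'; apply: specializesD => //; rewrite -mulN1r -(mulN1r c').
by apply: specializesM zc'; have := specializes_tofrac (-1); rewrite tofracN tofrac1 rmorphN1.
Qed.

Lemma specializesV z c : c != 0 -> specializes z c -> specializes z^-1 c^-1.
Proof.
move=> c0 [n [d [d0 zd cd]]].
have n0 : ev n != 0 by rewrite -cd mulf_neq0.
have z0 : z != 0.
  apply: contraNneq n0 => z0; move/eqP: zd; rewrite z0 mul0r eq_sym tofrac_eq0.
  by move=> /eqP->; rewrite rmorph0.
by exists d, n; rewrite n0 -zd -cd !mulKf.
Qed.

Lemma specializes_neq0 z c : c != 0 -> specializes z c -> z != 0.
Proof.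
move=> c0 zc; apply: contraNneq c0 => z0; apply/eqP/(specializes_inj zc).
by rewrite z0; exact: specializes0.
Qed.

Lemma specializesX z c k : specializes z c -> specializes (z ^+ k) (c ^+ k).
Proof.
move=> zc; elim: k => [|k ih]; first exact: specializes1.
by rewrite !exprS; apply: specializesM.
Qed.

Lemma specializes_sum (I : eqType) (s : seq I) (f : I -> {fraction R}) (g : I -> L) :
  {in s, forall i, specializes (f i) (g i)} ->
  specializes (\sum_(i <- s) f i) (\sum_(i <- s) g i).
Proof.
move=> fg; rewrite big_seq [X in specializes _ X]big_seq.
elim/big_ind2: _ => //; first exact: specializes0.
by move=> *; apply: specializesD.
Qed.

Lemma specializes_prod (I : eqType) (s : seq I) (f : I -> {fraction R}) (g : I -> L) :
  {in s, forall i, specializes (f i) (g i)} ->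
  specializes (\prod_(i <- s) f i) (\prod_(i <- s) g i).
Proof.
move=> fg; rewrite big_seq [X in specializes _ X]big_seq.
elim/big_ind2: _ => //; first exact: specializes1.
by move=> *; apply: specializesM.
Qed.

End Specialization.

(** * Limits at [eps = 0] over the field of rational functions in [eps] *)

Section SpecializationAtZero.
Variable F : fieldType.
Local Notation K := {fraction {poly F}}.
Local Notation tofrac := (@FracField.tofrac {poly F}).
Local Notation specializes := (specializes (horner_eval (0 : F))).

Definition cst (c : F) : K := tofrac c%:P.
HB.instance Definition _ := GRing.RMorphism.copy cst (tofrac \o polyC).

Definition eps : K := tofrac 'X.

Lemma eps_neq0 : eps != 0.
Proof. by rewrite tofrac_eq0 polyX_eq0. Qed.

Lemma specializes_cst c : specializes (cst c) c.
Proof. by have := specializes_tofrac (horner_eval (0 : F)) c%:P; rewrite /= /horner_eval hornerC. Qed.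

Lemma specializes_eps : specializes eps 0.
Proof. by have := specializes_tofrac (horner_eval (0 : F)) 'X; rewrite /= /horner_eval hornerX. Qed.

(* By induction on the list of nodes, as in Newton interpolation. *)
Lemma specializes_coef (ts : seq F) (N : {poly K}) (P : {poly F}) :
  uniq ts -> (size N <= size ts)%N -> (size P <= size ts)%N ->
  {in ts, forall t, specializes N.[cst t] P.[t]} ->
  forall i, specializes N`_i P`_i.
Proof.
elim: ts N P => [|t ts ih] N P /=.
  by rewrite !leqn0 !size_poly_eq0 => _ /eqP-> /eqP-> _ i; rewrite !coef0; exact: specializes0.
move=> /andP[tts uts] sN sP NP.
pose N1 := N %/ ('X - (cst t)%:P); pose P1 := P %/ ('X - t%:P).
have eN : N = N1 * ('X - (cst t)%:P) + (N.[cst t])%:P.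
  by rewrite {1}(divp_eq N ('X - (cst t)%:P)) modp_XsubC.
have eP : P = P1 * ('X - t%:P) + (P.[t])%:P.
  by rewrite {1}(divp_eq P ('X - t%:P)) modp_XsubC.
have h : forall i, specializes N1`_i P1`_i.
  apply: ih => //.
  - by rewrite size_divp ?polyXsubC_eq0 // size_XsubC leq_subLR.
  - by rewrite size_divp ?polyXsubC_eq0 // size_XsubC leq_subLR.
  move=> u uts'; have ut : u - t != 0.
    by rewrite subr_eq0; apply: contraNneq tts => <-.
  have ut' : cst u - cst t != 0 by rewrite -rmorphB fmorph_eq0.
  (* Divided differences: the denominator specializes to [u - t], nonzero because the nodes are
     distinct, so both quotients meet the hypothesis at the remaining nodes. *)
  have -> : N1.[cst u] = (N.[cst u] - N.[cst t]) * (cst (u - t))^-1.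
    by apply: (mulIf ut'); rewrite rmorphB mulfVK // {1}eN !hornerE addrK.
  have -> : P1.[u] = (P.[u] - P.[t]) * (u - t)^-1.
    by apply: (mulIf ut); rewrite mulfVK // {1}eP !hornerE addrK.
  apply: specializesM; last by apply: specializesV => //; apply: specializes_cst.
  by apply: specializesB; apply: NP; rewrite !inE ?eqxx ?uts' ?orbT.
move=> i; rewrite eN eP !coefD !coefC !mulrBr !coefB !coefMX !coefMC.
have h0 : specializes (if i == 0%N then N.[cst t] else 0) (if i == 0%N then P.[t] else 0).
  by case: ifP => _; [apply: NP; rewrite mem_head | exact: specializes0].
apply: specializesD => //; apply: specializesB.
  by case: ifP => _; [exact: specializes0 | exact: h].
by apply: specializesM => //; exact: specializes_cst.
Qed.

End SpecializationAtZero.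

(** * The geometric R-matrix *)

Section Kappa.
Variables (F : fieldType) (n : nat).
Implicit Types (x y : 'I_n -> F) (r j : 'I_n).

Lemma val_shiftI r t : val (shiftI r t) = ((r + t) %% n)%N.
Proof.
by rewrite /shiftI val_insubd ltn_pmod //; case: r => r /= /(leq_ltn_trans _)->.
Qed.

Lemma shiftID r s t : shiftI (shiftI r s) t = shiftI r (s + t).
Proof. by apply: val_inj; rewrite !val_shiftI modnDml addnA. Qed.

Lemma shiftI0 r : shiftI r 0 = r.
Proof. by apply: val_inj; rewrite val_shiftI addn0 modn_small. Qed.

Lemma shiftIn r : shiftI r n = r.
Proof. by apply: val_inj; rewrite val_shiftI modnDr modn_small. Qed.

Lemma shiftI_subn r j : shiftI r (j + (n - r)) = j.
Proof.
apply: val_inj; rewrite val_shiftI addnCA subnKC ?modnDr ?modn_small //.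
exact: ltnW.
Qed.

Lemma shiftI_bij t : bijective (fun j => shiftI j t).
Proof.
apply: injF_bij => i j /(congr1 val); rewrite !val_shiftI => /eqP; rewrite eqn_modDr.
by rewrite !modn_small // => /eqP/val_inj.
Qed.

Lemma prod_shiftI (f : 'I_n -> F) r : \prod_(t < n) f (shiftI r t) = \prod_j f j.
Proof.
rewrite [RHS](reindex (fun t : 'I_n => shiftI r t)) //; apply: onW_bij.
apply: injF_bij => i j /(congr1 val); rewrite !val_shiftI => /eqP; rewrite eqn_modDl.
by rewrite !modn_small // => /eqP/val_inj.
Qed.

Lemma kappaE x y r : kappa x y r =
  \sum_(0 <= k < n) (\prod_(0 <= t < k) y (shiftI r t)) * \prod_(k.+1 <= t < n) x (shiftI r t).
Proof.
rewrite big_mkord; apply: eq_bigr => k _; congr (_ * _).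
- by rewrite big_mkord (big_ord_widen n (fun t => y (shiftI r t)) (ltnW (ltn_ord k))).
- by rewrite (big_nat_widenl _ 0) // big_mkord.
Qed.

(** Multiplying by [y r] lengthens the [y]-part of each term at the front; multiplying by [x r],
    which is also reached after [n] shifts, lengthens the [x]-part at the end. The two sums are then
    consecutive shifts of one sequence of products and telescope. *)
Lemma kappa_rec x y r :
  y r * kappa x y (shiftI r 1) - x r * kappa x y r = \prod_j y j - \prod_j x j.
Proof.
have n0 : (0 < n)%N by case: r => r /= /(leq_ltn_trans _)->.
pose g k := (\prod_(0 <= t < k) y (shiftI r t)) * \prod_(k.+1 <= t < n.+1) x (shiftI r t).
have -> : y r * kappa x y (shiftI r 1) = \sum_(0 <= k < n) g k.+1.
  rewrite kappaE mulr_sumr; apply: eq_big_nat => k /andP[_ kn].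
  rewrite /g big_nat_recl // shiftI0 mulrA; congr (_ * _ * _).
    by apply: eq_bigr => t _; rewrite shiftID add1n.
  by rewrite [RHS]big_add1 /=; apply: eq_bigr => t _; rewrite shiftID add1n.
have -> : x r * kappa x y r = \sum_(0 <= k < n) g k.
  rewrite kappaE mulr_sumr; apply: eq_big_nat => k /andP[_ kn].
  by rewrite /g big_nat_recr //= shiftIn; ring.
rewrite -sumrB telescope_sumr //; congr (_ - _); rewrite /g.
  by rewrite [X in _ * X]big_geq // mulr1 big_mkord prod_shiftI.
rewrite big_geq // mul1r big_add1 /= big_mkord -(prod_shiftI x (shiftI r 1)).
by apply: eq_bigr => t _; rewrite shiftID add1n.
Qed.

(** * Recovering the R-matrix from products and cyclic sums *)

Section Unique.
Variables (x y x' y' : 'I_n -> F).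
Hypotheses (x0 : forall j, x j != 0) (y0 : forall j, y j != 0)
  (xyM : forall j, x' j * y' j = x j * y j)
  (xyD : forall j, x' (shiftI j 1) + y' j = x (shiftI j 1) + y j)
  (xx' : forall j, x j != x' j) (XY : \prod_j x j != \prod_j y j).

(* The reciprocals [k j] of [x j - x' j] satisfy the recursion [kappa_rec] of
   the [kappa j], up to the factor [X - Y]; a periodic solution is unique. *)
Lemma kappa_eq j : kappa x y j = (\prod_j x j - \prod_j y j) / (x j - x' j).
Proof.
pose k j := (x j - x' j)^-1.
have d0 i : x i - x' i != 0 by rewrite subr_eq0.
have kE i : x i * k i - y i * k (shiftI i 1) = 1.
  have := d0 i; have := d0 (shiftI i 1); rewrite /k.
  set b := x (shiftI i 1) - x' _; set a := x i - x' i => b0 a0.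
  have yb : y' i = y i + b by apply: (addrI (x' (shiftI i 1))); rewrite xyD /b; ring.
  have xa : x' i = x i - a by rewrite /a; ring.
  have ab : x i * b - y i * a = a * b.
    have /eqP := xyM i; rewrite yb xa -subr_eq0 => /eqP e.
    by apply/eqP; rewrite -subr_eq0 -[X in _ == X]e; apply/eqP; ring.
  transitivity ((x i * b - y i * a) / (a * b)); first by field; rewrite a0 b0.
  by rewrite ab divff // mulf_neq0.
pose d i := kappa x y i - (\prod_j x j - \prod_j y j) * k i.
have dE i : x i * d i = y i * d (shiftI i 1).
  apply/eqP; rewrite -subr_eq0; apply/eqP; rewrite /d.
  transitivity (- (y i * kappa x y (shiftI i 1) - x i * kappa x y i) -
    (\prod_j x j - \prod_j y j) * (x i * k i - y i * k (shiftI i 1))); first by ring.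
  by rewrite kappa_rec kE; ring.
suff dj : d j = 0 by apply/eqP; rewrite -subr_eq0; apply/eqP.
(* The difference [d] of the two solutions obeys the homogeneous recursion [dE]. One nonzero value
   makes all of them nonzero, and multiplying around the cycle then gives equal products of the [x]
   and of the [y]. *)
apply/eqP; apply: contraNT XY => dj0.
have dn0 i : d i != 0.
  suff h t : d (shiftI j t) != 0 by rewrite -(shiftI_subn j i).
  elim: t => [|t ih]; first by rewrite shiftI0.
  have : y (shiftI j t) * d (shiftI (shiftI j t) 1) != 0 by rewrite -dE mulf_neq0.
  by rewrite shiftID addn1 mulf_eq0 negb_or => /andP[].
have D0 : \prod_i d i != 0 by apply/prodf_neq0 => i _.
apply/eqP; apply: (mulIf D0); rewrite -big_split /= (eq_bigr _ (fun i _ => dE i)) big_split /=.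
by congr (_ * _); rewrite [RHS](reindex (fun i => shiftI i 1)) //; apply: onW_bij; apply: shiftI_bij.
Qed.

Lemma kappa_neq0 j : kappa x y j != 0.
Proof. by rewrite kappa_eq mulf_neq0 ?invr_eq0 // subr_eq0. Qed.

(** Once [kappa] is known, eliminating [y'] by the two conservation laws gives the claim. The names
    cross: [Rmat_x'] is the new second row, called [y'] here. *)
Lemma Rmat_x'_eq j : Rmat_x' x y j = y' j.
Proof.
have d0 i : x i - x' i != 0 by rewrite subr_eq0.
have D0 : \prod_j x j - \prod_j y j != 0 by rewrite subr_eq0.
rewrite /Rmat_x' !kappa_eq.
set D := _ - _ in D0 *; set a := x (shiftI j 1) - x' _.
have a0 : a != 0 by exact: d0.
have yb : y' j = y j + a by apply: (addrI (x' (shiftI j 1))); rewrite xyD /a; ring.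
have e : y' j * (x j - x' j) = x j * a.
  have := xyM j; rewrite yb => /eqP; rewrite -subr_eq0 => /eqP e.
  by apply/eqP; rewrite -subr_eq0 -[X in _ == X]oppr0 -[X in _ == - X]e; apply/eqP; ring.
apply: (mulIf (d0 j)); rewrite e.
by field; rewrite a0 D0 d0.
Qed.

Lemma Rmat_y'_eq j : Rmat_y' x y j = x' j.
Proof.
have := Rmat_x'_eq j; have := xyM j; have k0 := kappa_neq0.
have y'0 : y' j != 0.
  by apply: contraTneq (mulf_neq0 (x0 j) (y0 j)) => e; rewrite -xyM e mulr0 eqxx.
move=> e e'; apply: (mulIf y'0); rewrite e -e' /Rmat_y' /Rmat_x'.
by field; rewrite !k0.
Qed.

End Unique.
End Kappa.

(** * A curve on which the R-matrix is an involution of the parameter *)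

Section Family.
Variables (F : fieldType) (n : nat) (r : 'I_n) (x y : 'I_n -> F).
Hypotheses (x0 : forall j, x j != 0) (y0 : forall j, y j != 0).
Local Notation xs t := (x (shiftI r t)).
Local Notation ys t := (y (shiftI r t)).

(** The cyclic distance from [r] to [j]. *)
Definition offset (j : 'I_n) : nat := (j + (n - r)) %% n.
(* With d_j = x_j - x_j(q), the constancy of the x_j y_j and x_{j+1} + y_j is the
   linear recursion x_j / d_j - y_j / d_{j+1} = 1; its solution gives
   [increment], [node] and [pencil]. *)
Definition increment (i : nat) : F := (\prod_(0 <= l < i) ys l) / \prod_(0 <= l < i.+1) xs l.
Definition node (i : nat) : F := \sum_(0 <= l < i) increment l.
Definition pencil (i : nat) (q : F) : F := (node n - node i) + node i * q.

(* The curve passes through [(x, y)] at [q = 1]. *)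
Definition curve_x (q : F) (j : 'I_n) : F := x j * pencil (offset j).+1 q / pencil (offset j) q.
Definition curve_y (q : F) (j : 'I_n) : F := y j * pencil (offset j) q / pencil (offset j).+1 q.
Definition ratio_xy : F := (\prod_j x j) / \prod_j y j.

Lemma n_gt0 : (0 < n)%N. Proof. by case: r => k /= /(leq_ltn_trans _)->. Qed.

Lemma offset_lt j : (offset j < n)%N. Proof. by rewrite ltn_pmod // n_gt0. Qed.

Lemma shiftI_offset j : shiftI r (offset j) = j.
Proof.
rewrite -[RHS](shiftI_subn r j); apply: val_inj.
by rewrite !val_shiftI /offset modnDmr.
Qed.

Lemma offset_shiftI t : (t < n)%N -> offset (shiftI r t) = t.
Proof.
move=> tn; rewrite /offset val_shiftI modnDml addnAC subnKC ?modnDl ?modn_small //.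
exact: ltnW.
Qed.

Lemma pencilS i q : pencil i.+1 q = pencil i q - increment i * (1 - q).
Proof. by rewrite /pencil /node big_nat_recr //=; ring. Qed.

Lemma pencil0 q : pencil 0 q = node n.
Proof. by rewrite /pencil [node 0]big_geq // mul0r subr0 addr0. Qed.

Lemma penciln q : pencil n q = node n * q.
Proof. by rewrite /pencil subrr add0r. Qed.

Lemma prodX_neq0 i : \prod_(0 <= l < i) xs l != 0.
Proof. by rewrite big_mkord; apply/prodf_neq0. Qed.

Lemma prodY_neq0 i : \prod_(0 <= l < i) ys l != 0.
Proof. by rewrite big_mkord; apply/prodf_neq0. Qed.

Lemma increment_neq0 i : increment i != 0.
Proof. by rewrite mulf_neq0 ?invr_eq0 ?prodX_neq0 ?prodY_neq0. Qed.

Lemma incrementS i : xs i.+1 * increment i.+1 = ys i * increment i.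
Proof.
rewrite /increment [X in X / _]big_nat_recr //= [X in _ / X]big_nat_recr //=.
by field; rewrite prodX_neq0 x0.
Qed.

Lemma increment0 : xs 0 * increment 0 = 1.
Proof. by rewrite /increment big_geq // big_nat1 mul1r divff. Qed.

Lemma increment_last i : i.+1 = n -> ys i * increment i = ratio_xy^-1.
Proof.
move=> ni; rewrite /increment mulrA [ys i * _]mulrC /ratio_xy invf_div.
have -> : (\prod_(0 <= l < i) ys l) * ys i = \prod_(0 <= l < i.+1) ys l by rewrite [RHS]big_nat_recr.
by rewrite ni !big_mkord !prod_shiftI.
Qed.

Lemma ratio_xy_neq0 : ratio_xy != 0.
Proof. by rewrite mulf_neq0 ?invr_eq0 //; apply/prodf_neq0. Qed.

Lemma curveM q j : (forall i, (i <= n)%N -> pencil i q != 0) ->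
  curve_x q j * curve_y q j = x j * y j.
Proof.
move=> p0; rewrite /curve_x /curve_y.
by field; rewrite !p0 // ?offset_lt // ltnW // offset_lt.
Qed.

Lemma curveD q j i : (forall i, (i <= n)%N -> pencil i q != 0) ->
  j = shiftI r i -> (i.+1 < n)%N ->
  curve_x q (shiftI j 1) + curve_y q j = x (shiftI j 1) + y j.
Proof.
move=> p0 -> i1; rewrite /curve_x /curve_y shiftID addn1 !offset_shiftI //; last exact: ltnW.
have p := p0 _ (ltnW i1).
have -> : pencil i q = pencil i.+1 q + increment i * (1 - q) by rewrite pencilS subrK.
rewrite (pencilS i.+1); apply: (mulIf p); rewrite mulrDl !mulfVK //.
have := incrementS i => /eqP; rewrite -subr_eq0 => /eqP e.
apply/eqP; rewrite -subr_eq0 -[X in _ == X](mulr0 (q - 1)) -[X in _ == _ * X]e; apply/eqP; ring.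
Qed.

(** In the column before [r], where the cycle closes, the sum does vary. Its deviation is symmetric
    under [q -> 1 / (A q)] with [A = ratio_xy], so the involution preserves this sum too. *)
Lemma curveD_last q j i : (forall i, (i <= n)%N -> pencil i q != 0) -> q != 0 ->
  j = shiftI r i -> i.+1 = n ->
  curve_x q (shiftI j 1) + curve_y q j = x (shiftI j 1) + y j +
    (q + (ratio_xy * q)^-1 - 1 - ratio_xy^-1) / node n.
Proof.
move=> p0 q0 -> i1; rewrite /curve_x /curve_y shiftID addn1 i1 shiftIn.
have il : (i < n)%N by rewrite -i1.
rewrite (offset_shiftI il).
have -> : offset r = 0%N by rewrite -{1}(shiftI0 r) offset_shiftI // n_gt0.
have -> : pencil i q = pencil i.+1 q + increment i * (1 - q) by rewrite pencilS subrK.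
have b0 : node n != 0 by rewrite -(pencil0 q) p0.
rewrite i1 (pencilS 0) pencil0 penciln.
have e := increment_last i1.
transitivity (x r + y (shiftI r i) + (1 - q) * (ys i * increment i - q * (xs 0 * increment 0)) / (node n * q)).
  by rewrite shiftI0; field; rewrite b0 q0.
by rewrite e increment0; field; rewrite b0 q0 ratio_xy_neq0.
Qed.

(** Around the cycle the ratios telescope from [pencil 0 = node n] to [pencil n = node n * q]. The
    parameter is thus the factor by which the product of the x_j grows along the curve. *)
Lemma prod_pencil q : (forall i, (i <= n)%N -> pencil i q != 0) ->
  \prod_j (pencil (offset j).+1 q / pencil (offset j) q) = q.
Proof.
move=> p0; rewrite -(prod_shiftI (fun j => pencil (offset j).+1 q / pencil (offset j) q) r).
rewrite (eq_bigr (fun t : 'I_n => pencil t.+1 q / pencil t q)); last first.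
  by move=> t _; rewrite offset_shiftI.
rewrite -(big_mkord xpredT (fun t => pencil t.+1 q / pencil t q)) telescope_prodf ?n_gt0 //.
  by rewrite penciln pencil0 mulrC mulKf // -(pencil0 q) p0.
by move=> k /andP[_ /ltnW kn]; apply: p0.
Qed.

Section Involution.
Variable q : F.
Let q' := (ratio_xy * q)^-1.
Hypotheses (q0 : q != 0) (qq' : q != q') (p0 : forall i, (i <= n)%N -> pencil i q != 0)
  (p'0 : forall i, (i <= n)%N -> pencil i q' != 0).

Let cx0 j : curve_x q j != 0.
Proof.
by rewrite !mulf_neq0 ?invr_eq0 ?p0 // ?offset_lt // ltnW // offset_lt.
Qed.

Let cy0 j : curve_y q j != 0.
Proof.
by rewrite !mulf_neq0 ?invr_eq0 ?p0 // ?offset_lt // ltnW // offset_lt.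
Qed.

Let cM j : curve_x q' j * curve_y q' j = curve_x q j * curve_y q j.
Proof. by rewrite !curveM. Qed.

Let q'0 : q' != 0.
Proof. by rewrite invr_eq0 mulf_neq0 // ratio_xy_neq0. Qed.

Let cD j : curve_x q' (shiftI j 1) + curve_y q' j = curve_x q (shiftI j 1) + curve_y q j.
Proof.
have jE := esym (shiftI_offset j); have := offset_lt j; rewrite leq_eqVlt => /orP[/eqP jn|jn].
  rewrite !(curveD_last _ _ jE jn) //; congr (_ + _ / _).
  have -> : (ratio_xy * q')^-1 = q by rewrite /q' invfM invrK mulKf // ratio_xy_neq0.
  by rewrite -/q'; ring.
by rewrite !(curveD _ jE jn).
Qed.

Let cxx' j : curve_x q j != curve_x q' j.
Proof.
have l := offset_lt j; have l' := ltnW l.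
rewrite /curve_x eqr_div ?p0 ?p'0 // -subr_eq0 !pencilS.
have -> : x j * (pencil (offset j) q - increment (offset j) * (1 - q)) * pencil (offset j) q' -
  x j * (pencil (offset j) q' - increment (offset j) * (1 - q')) * pencil (offset j) q =
  x j * increment (offset j) * node n * (q - q') by rewrite /pencil; ring.
have b0 : node n != 0 by rewrite -(pencil0 q) p0.
have d0 : q - q' != 0 by rewrite subr_eq0.
exact: mulf_neq0 (mulf_neq0 (mulf_neq0 (x0 j) (increment_neq0 _)) b0) d0.
Qed.

(** With [X] and [Y] the products of the x_j and of the y_j, equality would read [X * q = Y / q],
    that is [q = q']. *)
Let cXY : \prod_j curve_x q j != \prod_j curve_y q j.
Proof.
have Y0 : \prod_j y j != 0 by apply/prodf_neq0.
have X0 : \prod_j x j != 0 by apply/prodf_neq0.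
have -> : \prod_j curve_x q j = \prod_j x j * q.
  rewrite -[X in _ * X](prod_pencil p0) -big_split /=; apply: eq_bigr => j _.
  by rewrite /curve_x mulrA.
have -> : \prod_j curve_y q j = \prod_j y j / q.
  rewrite -[X in _ / X](prod_pencil p0) -prodfV -big_split /=; apply: eq_bigr => j _.
  by rewrite /curve_y invf_div mulrA.
apply: contraNneq qq' => e; apply/eqP; rewrite /q'.
have Aq0 := mulf_neq0 ratio_xy_neq0 q0; apply: (mulIf Aq0); rewrite mulVf //.
transitivity ((\prod_j x j * q) * q / \prod_j y j); first by rewrite /ratio_xy; field.
by rewrite e mulfVK // divff.
Qed.

(** The points at [q] and [q'] have the same products and cyclic sums, so the characterization of R
    applies with the point at [q'] as the second solution. *)
Lemma curve_kappa_neq0 j : kappa (curve_x q) (curve_y q) j != 0.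
Proof. by apply: (@kappa_neq0 _ _ _ _ (curve_x q') (curve_y q')). Qed.

Lemma curve_Rmat_x' j : Rmat_x' (curve_x q) (curve_y q) j = curve_y q' j.
Proof. by apply: (@Rmat_x'_eq _ _ _ _ (curve_x q') (curve_y q')). Qed.

Lemma curve_Rmat_y' j : Rmat_y' (curve_x q) (curve_y q) j = curve_x q' j.
Proof. by apply: (@Rmat_y'_eq _ _ _ _ (curve_x q') (curve_y q')). Qed.

End Involution.
End Family.

(** * Laurent polynomials invariant under an inversion *)

Section Laurent.
Variables (K : fieldType) (e : nat -> K).
Hypothesis e_inj : injective e.

(** Fewer than [size Z] of the distinct values [e k] are roots of [Z], so enough remain among the
    first [s + size Z]. *)
Lemma many_nonroots (Z : {poly K}) s : Z != 0 ->
  exists ks : seq nat, [/\ uniq ks, size ks = s & {in ks, forall k, Z.[e k] != 0}].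
Proof.
move=> Z0; pose nz (k : nat) := Z.[e k] != 0; pose ks := [seq k <- iota 0 (s + size Z) | nz k].
have uks : uniq ks by rewrite filter_uniq ?iota_uniq.
have sks : (s <= size ks)%N.
  have := count_predC nz (iota 0 (s + size Z)).
  rewrite -!size_filter size_iota => es.
  rewrite -(leq_add2r (size Z)) -es leq_add2l.
  rewrite -(size_map e); set rs := map _ _.
  have rsZ : all (root Z) rs.
    by apply/allP => _ /mapP[k + ->]; rewrite mem_filter /= negbK => /andP[].
  have urs : uniq rs by rewrite map_inj_uniq // filter_uniq ?iota_uniq.
  exact: ltnW (max_poly_roots Z0 rsZ urs).
exists (take s ks); split; first exact: take_uniq.
  by rewrite size_take_min (minn_idPl sks).
by move=> k /mem_take; rewrite mem_filter => /andP[].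
Qed.

Lemma poly_eq_nonroots (Z P Q : {poly K}) : Z != 0 ->
  (forall t, Z.[t] != 0 -> P.[t] = Q.[t]) -> P = Q.
Proof.
move=> Z0 PQ; apply/eqP; rewrite -subr_eq0; apply: contraT => R0.
have [ks [uks sks ksZ]] := many_nonroots (size (P - Q)) Z0.
have: (size [seq e k | k <- ks] < size (P - Q)%R)%N.
  apply: max_poly_roots => //; last by rewrite map_inj_uniq.
  apply/allP => _ /mapP[k kks ->].
  by rewrite rootE hornerD hornerN (PQ _ (ksZ _ kks)) subrr.
by rewrite size_map sks ltnn.
Qed.

(** The polynomial t^s P(1/(A t)), once [s] bounds the degree of [P]. *)
Definition reflect_poly (A : K) (s : nat) (P : {poly K}) : {poly K} :=
  \poly_(i < s.+1) (P`_(s - i) / A ^+ (s - i)).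

Lemma horner_reflect_poly (A : K) s (P : {poly K}) (t : K) : A != 0 -> t != 0 -> (size P <= s.+1)%N ->
  (reflect_poly A s P).[t] = t ^+ s * P.[(A * t)^-1].
Proof.
move=> A0 t0 sP; rewrite horner_poly (horner_coef_wide _ sP) mulr_sumr.
rewrite (reindex_inj rev_ord_inj) /=; apply: eq_bigr => i _.
rewrite subSS subKn -1?ltnS // exprVn exprMn.
have -> : t ^+ s = t ^+ (s - i) * t ^+ i by rewrite -exprD subnK // -ltnS.
by field; rewrite !expf_neq0.
Qed.

Variables (A : K) (qs : seq K) (N Z : {poly K}) (b : nat) (g : K -> K).
Let G : {poly K} := \prod_(c <- qs) ('X - c%:P).
Let D : {poly K} := 'X * G.
Hypotheses (A0 : A != 0) (Aqq : {in qs &, forall c d, A * c * d != 1}) (Z0 : Z != 0)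
  (gN : forall t, D.[t] != 0 -> D.[t] ^+ b * g t = N.[t])
  (gg : forall t, Z.[t] != 0 -> g t = g (A * t)^-1).

(** [D] at [1 / (A t)], cleared of its denominator; a nonzero [c] in [qs] contributes the root
    [1 / (A c)]. *)
Let H : {poly K} := A^-1%:P * \prod_(c <- qs) (A^-1%:P - c *: 'X).

Let horner_G t : G.[t] = \prod_(c <- qs) (t - c).
Proof. by rewrite horner_prod; apply: eq_bigr => c _; rewrite hornerXsubC. Qed.

Let horner_H t : H.[t] = A^-1 * \prod_(c <- qs) (A^-1 - c * t).
Proof.
rewrite hornerM hornerC horner_prod; congr (_ * _).
by apply: eq_bigr => c _; rewrite !hornerE.
Qed.

Let H_D t : t != 0 -> H.[t] = t ^+ (size qs).+1 * D.[(A * t)^-1].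
Proof.
move=> t0; rewrite horner_H hornerM hornerX horner_G exprS -mulrA [X in t * X]mulrCA.
have -> : t ^+ size qs * \prod_(c <- qs) ((A * t)^-1 - c) = \prod_(c <- qs) (A^-1 - c * t).
  elim: qs => [|c l ih]; first by rewrite !big_nil mulr1.
  by rewrite !big_cons -ih exprS; field; rewrite t0 A0.
by rewrite mulrA invfM mulrCA divff // mulr1.
Qed.

Let D_neq0 : D != 0.
Proof. by rewrite mulf_neq0 ?polyX_eq0 // monic_neq0 // monic_prod_XsubC. Qed.

Let H_neq0 : H != 0.
Proof.
rewrite mulf_neq0 ?polyC_eq0 ?invr_eq0 // prodf_seq_neq0; apply/allP => c _ /=.
apply: contraNneq A0 => /(congr1 (fun p => p.[0])).
by rewrite hornerD hornerN hornerZ hornerC hornerX horner0 mulr0 subr0 => /eqP; rewrite invr_eq0.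
Qed.

Let W : {poly K} := Z * D * H.
Let W_neq0 : W != 0. Proof. exact: mulf_neq0 (mulf_neq0 Z0 D_neq0) H_neq0. Qed.

Let nonroot_W t : W.[t] != 0 -> [/\ t != 0, Z.[t] != 0, D.[t] != 0 & D.[(A * t)^-1] != 0].
Proof.
rewrite /W [X in X != 0]hornerM mulf_eq0 negb_or => /andP[+ Ht].
rewrite hornerM mulf_eq0 negb_or => /andP[Zt Dt].
have t0 : t != 0 by apply: contraNneq Dt => ->; rewrite hornerM hornerX mul0r.
by split=> //; move: Ht; rewrite H_D // mulf_eq0 negb_or => /andP[].
Qed.

(* The poles of [g] off [0] are among the [c] in [qs]; the symmetry carries [c]
   to [1 / (A c)], which is not a pole.  Hence [g] is a Laurent polynomial. *)
Let laurent : exists k M, forall t, D.[t] != 0 -> t ^+ k * g t = M.[t].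
Proof.
pose s := ((size qs).+1 * b + size N)%N; pose k := size N.
(* Both sides are [t^k D^b H^b g], expressed through [gN] at [t] on the left and at [1 / (A t)] on
   the right; [s] is the power of [t] that this takes. *)
have key : N * 'X^k * H ^+ b = reflect_poly A s N * D ^+ b.
  apply: (poly_eq_nonroots W_neq0) => t /nonroot_W[t0 Zt Dt Dt'].
  rewrite !hornerM !horner_exp hornerX horner_reflect_poly //; last by rewrite /s; lia.
  rewrite -(gN Dt) -(gN Dt') -(gg Zt) H_D // exprMn -exprM /s exprD /k.
  by ring.
have cop : coprimep (G ^+ b) (H ^+ b).
  apply/coprimep_expl/coprimep_expr; rewrite /G big_seq.
  elim/big_ind: _ => [|p q cp cq|c cqs]; first exact: coprime1p.
    by rewrite coprimepMl cp.
  rewrite coprimep_sym coprimep_XsubC rootE horner_H mulf_neq0 ?invr_eq0 //.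
  rewrite prodf_seq_neq0; apply/allP => d dqs /=.
  apply: contraNneq (Aqq dqs cqs) => h.
  by rewrite -mulrA -(subr0_eq h) mulfV.
have /dvdpP[M eM] : G ^+ b %| N * 'X^k.
  rewrite -(Gauss_dvdpl _ cop) key exprMn mulrA dvdp_mull //.
exists (b + k)%N, M => t Dt.
have [t0 Gt] : t != 0 /\ G.[t] != 0.
  by move: Dt; rewrite hornerM hornerX mulf_eq0 negb_or => /andP[].
apply: (mulIf (expf_neq0 b Gt)).
have := congr1 (fun p => p.[t]) eM; rewrite !hornerM !horner_exp hornerX => <-.
by rewrite -(gN Dt) hornerM hornerX exprMn exprD; ring.
Qed.

(** [M] lists the Laurent coefficients g_k of [g], with g_0 at index [a]; comparing g(t) with g(1/(A
    t)) gives g_{-i} = A^{-i} g_i. The bound [a0] makes the shift as large as a later exponent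
    requires. *)
Lemma reflect_invariant_laurent a0 :
  exists a M, [/\ (a0 <= a)%N,
    forall t, D.[t] != 0 -> t ^+ a * g t = M.[t] &
    forall i, (i <= a)%N -> M`_(a - i) = M`_(a + i) / A ^+ i].
Proof.
have [k [M kM]] := laurent; pose m := (a0 + size M)%N; pose a := (k + m)%N.
(* The factor ['X^m] brings the degree to at most [2a], so reflecting the exponents about [a] loses
   no coefficient. *)
have sM : (size (M * 'X^m)%R <= (a.*2).+1)%N.
  apply: leq_trans (size_polyMleq _ _) _; rewrite size_polyXn /a /m; lia.
have aM t : D.[t] != 0 -> t ^+ a * g t = (M * 'X^m).[t].
  by move=> Dt; rewrite hornerM hornerXn -kM // /a exprD; ring.
exists a, (M * 'X^m); split=> // [|i ia]; first by rewrite /a /m; lia.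
have eM : M * 'X^m = A ^+ a *: reflect_poly A a.*2 (M * 'X^m).
  apply: (poly_eq_nonroots W_neq0) => t /nonroot_W[t0 Zt Dt Dt'].
  rewrite hornerZ horner_reflect_poly // -!aM // -(gg Zt) -addnn exprD.
  by rewrite exprVn exprMn; field; rewrite !expf_neq0.
rewrite {1}eM coefZ coef_poly ifT; last by lia.
have -> : (a.*2 - (a - i) = a + i)%N by lia.
by rewrite exprD; field; rewrite !expf_neq0.
Qed.

End Laurent.

(** * Evaluating invariants at points *)

Lemma mpoly_ring_ind (R : comNzRingType) n (P : {mpoly R[n]} -> Prop) :
  (forall c, P c%:MP) -> (forall i, P 'X_i) ->
  (forall p q, P p -> P q -> P (p + q)) -> (forall p q, P p -> P q -> P (p * q)) ->
  forall p, P p.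
Proof.
move=> PC PX PD PM; elim/mpolyind => [|c m p _ _ Pp]; first by rewrite -mpolyC0.
apply: (PD) => //; rewrite -mul_mpolyC; apply: (PM) => //; rewrite mpolyXE_id.
apply: (big_ind P) => [||i _]; [by rewrite -mpolyC1 | exact: (PM) |].
by elim: (m i) => [|k ih]; rewrite ?expr0 -?mpolyC1 // exprS; apply: PM.
Qed.

Lemma mmap_common_denominator (F K : fieldType) (iota : {rmorphism F -> K}) n
    (h : K -> 'I_n -> K) (D : {poly K}) :
  (forall v, exists Q : {poly K}, forall t, D.[t] != 0 -> D.[t] * h t v = Q.[t]) ->
  forall p : {mpoly F[n]}, exists b (Q : {poly K}),
    forall t, D.[t] != 0 -> D.[t] ^+ b * mmap iota (h t) p = Q.[t].
Proof.
move=> hD; elim/mpoly_ring_ind => [c|v|p q [b [P bP]] [c [Q cQ]]|p q [b [P bP]] [c [Q cQ]]].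
- by exists 0%N, (iota c)%:P => t _; rewrite mul1r mmapC hornerC.
- have [Q DQ] := hD v; exists 1%N, Q => t Dt.
  by rewrite -DQ // mmapX mmap1U expr1.
- exists (b + c)%N, (D ^+ c * P + D ^+ b * Q) => t Dt.
  by rewrite hornerD !hornerM !horner_exp -bP // -cQ // mmapD exprD; ring.
- exists (b + c)%N, (P * Q) => t Dt.
  by rewrite hornerM -bP // -cQ // rmorphM /= exprD; ring.
Qed.

Lemma rmorph_kappa (R S : comNzRingType) (f : {rmorphism R -> S}) n (x y : 'I_n -> R) r :
  f (kappa x y r) = kappa (f \o x) (f \o y) r.
Proof. by rewrite rmorph_sum; apply: eq_bigr => k _; rewrite rmorphM !rmorph_prod. Qed.

Definition frac_cst (m n : nat) : {rmorphism Cplx -> ratfun m n} :=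
  @FracField.tofrac _ \o @mpolyC (nvars m n) Cplx.

Lemma Ri_actE m n i p :
  Ri_act i p = mmap (@frac_cst m n) (fun v => Ri_subst i (enum_val v)) p.
Proof. by []. Qed.

Section SpecializeRi.
Variables (m n i : nat) (i1m : (i.+1 < m)%N) (L : fieldType)
  (iota : {rmorphism Cplx -> L}).
Implicit Types (x y : 'I_n -> L) (v : 'I_m * 'I_n -> L).

Definition rows_point x y v (a : 'I_m * 'I_n) : L :=
  if a.1 == i :> nat then x a.2 else if a.1 == i.+1 :> nat then y a.2 else v a.

(** Invariance is an identity of rational functions. It can be evaluated wherever the [kappa] do not
    vanish, these being the only denominators in R_i. *)
Lemma specialize_Ri_invariant x y v (p : {mpoly Cplx[nvars m n]}) :
  (forall j, kappa x y j != 0) -> R_invariant p ->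
  mmap iota (rows_point (Rmat_y' x y) (Rmat_x' x y) v \o enum_val) p =
  mmap iota (rows_point x y v \o enum_val) p.
Proof.
move=> kap0 /(_ i i1m) pinv.
pose ev : {rmorphism {mpoly Cplx[nvars m n]} -> L} := mmap iota (rows_point x y v \o enum_val).
suff h : specializes ev (Ri_act i p)
    (mmap iota (rows_point (Rmat_y' x y) (Rmat_x' x y) v \o enum_val) p).
  by apply: (specializes_inj h); rewrite pinv; exact: specializes_tofrac.
pose k0 : 'I_m := Ordinal (ltnW i1m); pose k1 : 'I_m := Ordinal i1m.
have evX k j : ev (xv k j) = rows_point x y v (k, j).
  by rewrite /ev /= /xv mmapX mmap1U /= enum_rankK.
have evx j : ev (xv k0 j) = x j by rewrite evX /rows_point eqxx.
have evy j : ev (xv k1 j) = y j by rewrite evX /rows_point gtn_eqF ?eqxx.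
have sk (k : 'I_m) j : specializes ev (xf k j) (rows_point x y v (k, j)).
  by rewrite -evX; exact: specializes_tofrac.
have sx j : specializes ev (xf k0 j) (x j) by rewrite -evx; exact: specializes_tofrac.
have sy j : specializes ev (xf k1 j) (y j) by rewrite -evy; exact: specializes_tofrac.
have skap j : specializes ev (kappa (xf k0) (xf k1) j) (kappa x y j).
  have := specializes_tofrac ev (kappa (xv k0) (xv k1) j); rewrite !rmorph_kappa.
  rewrite (_ : kappa (ev \o _) _ j = kappa x y j) //.
  apply: eq_bigr => k _; congr (_ * _); apply: eq_bigr => t _; first by rewrite /= evy.
  by rewrite /= evx.
rewrite Ri_actE; elim/mpoly_ring_ind: p {pinv} => [c|u|p q hp hq|p q hp hq].
- by have := specializes_tofrac ev c%:MP; rewrite /ev /= !mmapC.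
- rewrite !mmapX !mmap1U /= /Ri_subst /rows_point; set a := enum_val u.
  have -> : insubd a.1 i = k0 by apply: val_inj; rewrite val_insubd ltnW.
  have -> : insubd a.1 i.+1 = k1 by apply: val_inj; rewrite val_insubd i1m.
  case: ifP => ai; [|case: ifP => ai1].
  + exact: (specializesM (specializesM (sy _) (skap _)) (specializesV (kap0 _) (skap _))).
  + exact: (specializesM (specializesM (sx _) (skap _)) (specializesV (kap0 _) (skap _))).
  + by have := sk a.1 a.2; rewrite /rows_point ai ai1 -surjective_pairing.
- by rewrite !mmapD; apply: specializesD.
- by rewrite !rmorphM; apply: specializesM.
Qed.

End SpecializeRi.

Lemma eq_mmap (R : nzRingType) (S : nzRingType) n (f : R -> S) (h h' : 'I_n -> S) p :
  h =1 h' -> mmap f h p = mmap f h' p.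
Proof.
move=> hh'; apply: eq_bigr => m _; congr (_ * _).
by apply: eq_bigr => v _; rewrite hh'.
Qed.

(** * Weights representing the monomial order *)

Section Weights.
Local Open Scope nat_scope.

(** The number with base-[B] digits [u 0, ..., u (N-1)], most significant first, when these are
    below [B]. *)
Definition base_value (B N : nat) (u : nat -> nat) := \sum_(v < N) u v * B ^ (N - v.+1).

Lemma base_valueS B N u : base_value B N.+1 u = base_value B N u * B + u N.
Proof.
rewrite /base_value big_ord_recr /= subnn expn0 muln1; congr (_ + _).
rewrite big_distrl /=; apply: eq_bigr => v _.
by rewrite -mulnA -expnSr subSS -subSn ?subSS.
Qed.

Lemma base_value_lt B N u : (forall v, u v < B) -> base_value B N u < B ^ N.
Proof.
move=> uB; elim: N => [|N ih]; first by rewrite /base_value big_ord0.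
rewrite base_valueS expnSr; apply: leq_trans (leq_mul ih (leqnn B)).
by rewrite mulSn addnC ltn_add2r uB.
Qed.

Lemma base_value_lex B N u u' i : i < N -> (forall v, u v < B) ->
  (forall v, v < i -> u v = u' v) -> u i < u' i -> base_value B N u < base_value B N u'.
Proof.
move=> iN uB e ui; elim: N iN => // N ih; rewrite !base_valueS ltnS leq_eqVlt.
case/orP => [/eqP iN|/ih lt].
  rewrite -iN (_ : base_value B i u = base_value B i u') ?ltn_add2l //.
  by apply: eq_bigr => v _; rewrite e.
apply: leq_trans (leq_addr _ _); apply: leq_trans (leq_mul lt (leqnn B)).
by rewrite mulSn addnC ltn_add2r uB.
Qed.

(* Large enough digits turn the graded lexicographic order into a linear form. *)
Lemma mlead_weight (R : nzRingType) N (p : {mpoly R[N]}) :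
  exists w : 'I_N -> nat,
    (forall v v' : 'I_N, v < v' -> w v' < w v) /\
    forall m, m \in msupp p -> m != mlead p -> \sum_v m v * w v < \sum_v mlead p v * w v.
Proof.
(* [B] exceeds every exponent occurring in [p], and is at least 2, so its powers strictly
   increase. *)
pose B := (msize p).+2; pose u (m : 'X_{1..N}) k := nth 0 m k.
(* The summand [B ^ N] lets the total degree decide first; the powers [B ^ (N - v.+1)] settle ties
   lexicographically. *)
exists (fun v => B ^ N + B ^ (N - v.+1)); split.
  move=> v v' vv'; rewrite ltn_add2l ltn_exp2l //; have := ltn_ord v'; lia.
have WE (m : 'X_{1..N}) : \sum_v m v * (B ^ N + B ^ (N - v.+1)) = mdeg m * B ^ N + base_value B N (u m).
  rewrite mdegE big_distrl -big_split /=; apply: eq_bigr => v _.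
  by rewrite mulnDr (mnm_nth 0).
have uB m : m \in msupp p -> forall k, u m k < B.
  move=> mp k; have [kN|kN] := ltnP k N; last by rewrite /u nth_default ?size_tuple.
  apply: leq_trans (_ : (mdeg m).+1 <= _); last first.
    by have := msize_mdeg_lt mp; rewrite /B; lia.
  by rewrite ltnS mdegE (bigD1 (Ordinal kN)) //= (mnm_nth 0) leq_addr.
move=> m mp mM; have p0 : p != 0%R by apply: contraTneq mp => ->; rewrite msupp0.
have lt : (m < mlead p)%O by rewrite lt_neqAle mM msupp_le_mlead.
rewrite !WE; have := lemc_mdeg (Order.POrderTheory.ltW lt); rewrite leq_eqVlt => /orP[/eqP dE|dlt].
  rewrite dE ltn_add2l; have [i ei li] := ltmcP dE lt.
  apply: (base_value_lex (i := i)) => //; first exact: uB.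
    move=> v vi; have vN := ltn_trans vi (ltn_ord i).
    by have := ei (Ordinal vN) vi; rewrite !(mnm_nth 0).
  by move: li; rewrite !(mnm_nth 0).
apply: leq_trans (leq_addr _ _); apply: leq_trans (leq_mul dlt (leqnn _)).
by rewrite mulSn addnC ltn_add2r base_value_lt //; exact: uB.
Qed.

Lemma index_allpairs (T1 T2 : eqType) (s1 : seq T1) (s2 : seq T2) a b c d :
  a \in s1 -> b \in s2 -> index a s1 < index c s1 ->
  index (a, b) [seq (x, y) | x <- s1, y <- s2] < index (c, d) [seq (x, y) | x <- s1, y <- s2].
Proof.
elim: s1 => //= x s1 ih; rewrite inE !index_cat.
have in_head z t : ((z, t) \in [seq (x, y) | y <- s2]) = (z == x) && (t \in s2).
  apply/mapP/andP => [[y ys [-> ->]]|[/eqP-> ts]]; first by rewrite eqxx.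
  by exists t.
rewrite !in_head !(eq_sym x); case: (eqVneq a x) => /= [-> _ bs|ax as1 bs].
  case: (eqVneq c x) => //= _ _; rewrite bs.
  by apply: leq_trans (leq_addr _ _); rewrite index_mem in_head eqxx bs.
case: (eqVneq c x) => //= cx; rewrite ltnS => lt.
by rewrite ltn_add2l ih.
Qed.

(** A product type is enumerated row by row. As weights decrease along the enumeration, every weight
    in a row exceeds every weight in the next one. *)
Lemma enum_rank_row m n (a b : 'I_m * 'I_n) : a.1 < b.1 -> enum_rank a < enum_rank b.
Proof.
move=> ab; have rankE (c : 'I_m * 'I_n) : nat_of_ord (enum_rank c) = index c (enum {: 'I_m * 'I_n}).
  by rewrite -{2}(enum_rankK c) /enum_val index_uniq // ?enum_uniq // -cardE.
rewrite !rankE enumT unlock /= /prod_enum [a]surjective_pairing [b]surjective_pairing.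
by rewrite index_allpairs ?mem_enum // !index_enum_ord.
Qed.

End Weights.

(** * Poles of the curve as a function of its parameter *)

Section CurvePoles.
Variables (F : fieldType) (n : nat) (r : 'I_n) (x y : 'I_n -> F).
Hypotheses (x0 : forall j, x j != 0) (y0 : forall j, y j != 0).
Hypothesis node_neq0 : forall i, (0 < i <= n)%N -> node r x y i != 0.
Local Notation node := (node r x y).
Local Notation pencil := (pencil r x y).
Local Notation A := (ratio_xy x y).
Let n0 := n_gt0 r.
Let nn0 : node n != 0. Proof. by rewrite node_neq0 // n0 leqnn. Qed.

Definition pole i := (node i - node n) / node i.
(** Index 0 is left out because [pencil 0] is constant, index [n] because its zero is 0, which the
    factor ['X] of [D] accounts for. *)
Definition poles := [seq pole i | i <- iota 1 n.-1].
Let G : {poly F} := \prod_(c <- poles) ('X - c%:P).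
Let D := 'X * G.

Lemma pencil_pole i t : (0 < i <= n)%N -> pencil i t = node i * (t - pole i).
Proof. by move=> i0; rewrite /pencil /pole; field; exact: node_neq0. Qed.

Lemma pencil_dvd i : (i <= n)%N -> exists Q : {poly F},
  forall t, D.[t] != 0 -> pencil i t != 0 /\ D.[t] / pencil i t = Q.[t].
Proof.
move=> lin; have [->|i0] := posnP i.
  exists ((node n)^-1 *: D) => t Dt; rewrite pencil0; split; first exact: nn0.
  by rewrite hornerZ mulrC.
have i0n : (0 < i <= n)%N by rewrite i0.
have ni0 := node_neq0 i0n.
suff [Q DQ] : exists Q, D = Q * ('X - (pole i)%:P).
  exists ((node i)^-1 *: Q) => t; rewrite DQ hornerM hornerXsubC mulf_eq0 negb_or => /andP[Q0 t0].
  rewrite pencil_pole // mulf_neq0 //; split=> //.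
  by rewrite hornerZ; field; rewrite t0 ni0.
have [ltin|] := ltnP i n; last first.
  move=> ni; have -> : i = n by apply/eqP; rewrite eqn_leq lin.
  by exists G; rewrite /pole subrr mul0r subr0 mulrC.
apply/dvdpP; rewrite dvdp_mull // dvdp_XsubCl root_prod_XsubC.
by apply: map_f; rewrite mem_iota; lia.
Qed.

(** [Z] gathers finitely many excluded values: 0, the fixed points of t -> 1/(A t), and the zeros of
    the pencils at [t] and at [1 / (A t)]. *)
Lemma generic_nonroots : exists Z : {poly F}, Z != 0 /\
  forall t, Z.[t] != 0 -> [/\ t != 0, t != (A * t)^-1,
    forall i, (i <= n)%N -> pencil i t != 0 &
    forall i, (i <= n)%N -> pencil i (A * t)^-1 != 0].
Proof.
have A0 : A != 0 := ratio_xy_neq0 x0 y0.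
pose P1 i : {poly F} := (node n - node i)%:P + node i *: 'X.
pose P2 i : {poly F} := ((node n - node i) * A) *: 'X + (node i)%:P.
have P1E i t : (P1 i).[t] = pencil i t by rewrite /P1 !hornerE.
have P2E i t : t != 0 -> (P2 i).[t] = A * t * pencil i (A * t)^-1.
  by move=> t0; rewrite /P2 /pencil hornerD hornerC hornerZ hornerX; field; rewrite A0 t0.
have P0 i : (i <= n)%N -> (P1 i != 0) && (P2 i != 0).
  have [->|i0] := posnP i => lin.
    have n00 : node 0 = 0 by rewrite /node big_geq.
    rewrite /P1 /P2 n00 subr0 scale0r addr0 addr0 polyC_eq0 nn0 /=.
    by rewrite -mul_polyC mulf_neq0 ?polyX_eq0 // polyC_eq0 mulf_neq0.
  have ni0 : node i != 0 by rewrite node_neq0 ?i0.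
  apply/andP; split.
    apply: contraNneq ni0 => /(congr1 (fun p : {poly F} => p`_1)).
    by rewrite /P1 coefD coefC coefZ coefX coef0 /= mulr1 add0r => ->.
  apply: contraNneq ni0 => /(congr1 (fun p : {poly F} => p`_0)).
  by rewrite /P2 coefD coefC coefZ coefX coef0 /= mulr0 add0r => ->.
pose Z : {poly F} := 'X * (A *: 'X^2 - 1) * \prod_(i < n.+1) (P1 i * P2 i).
exists Z; split.
  apply: mulf_neq0; first (apply: mulf_neq0; first by rewrite polyX_eq0).
    apply: contraNneq (oner_neq0 F) => /(congr1 (fun p : {poly F} => p`_0)).
    by rewrite coefB coefZ coefXn coef1 coef0 /= mulr0 sub0r => /eqP; rewrite oppr_eq0.
  by apply/prodf_neq0 => i _; have /andP[? ?] := P0 i (ltn_ord i); rewrite mulf_neq0.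
move=> t; rewrite hornerM mulf_eq0 negb_or => /andP[].
rewrite hornerM hornerX mulf_eq0 negb_or => /andP[t0 At].
rewrite horner_prod => /prodf_neq0 PP.
have {}PP i : (i <= n)%N -> (pencil i t != 0) && (pencil i (A * t)^-1 != 0).
  move=> lin; have := PP (inord i) isT; rewrite inordK // hornerM P1E P2E //.
  by rewrite !mulf_eq0 !negb_or => /andP[-> /andP[_ ->]].
split=> //; try by move=> i /PP /andP[].
apply: contraNneq At => e; rewrite hornerD hornerN hornerZ hornerXn hornerC subr_eq0 expr2 mulrA.
by rewrite {2}e mulfV // mulf_neq0.
Qed.

Lemma curve_x_poly j : exists Q : {poly F}, forall t, D.[t] != 0 ->
  D.[t] * curve_x r x y t j = Q.[t].
Proof.
have [Q DQ] := pencil_dvd (ltnW (offset_lt r j)).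
exists (x j *: (((node n - node (offset r j).+1)%:P + node (offset r j).+1 *: 'X) * Q)) => t Dt.
rewrite /curve_x hornerZ [in RHS]hornerM -(proj2 (DQ t Dt)) hornerD hornerC hornerZ hornerX.
by rewrite /pencil; ring.
Qed.

Lemma curve_y_poly j : exists Q : {poly F}, forall t, D.[t] != 0 ->
  D.[t] * curve_y r x y t j = Q.[t].
Proof.
have [Q DQ] := pencil_dvd (offset_lt r j).
exists (y j *: (((node n - node (offset r j))%:P + node (offset r j) *: 'X) * Q)) => t Dt.
rewrite /curve_y hornerZ [in RHS]hornerM -(proj2 (DQ t Dt)) hornerD hornerC hornerZ hornerX.
by rewrite /pencil; ring.
Qed.

End CurvePoles.

(** * Limits along the curve through a point with entries of prescribed order in [eps] *)

Section BasePoint.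
Variables (F : fieldType) (n : nat) (r : 'I_n) (wx wy : 'I_n -> nat) (eta : F).
Hypotheses (eta0 : eta != 0) (wyx : forall j j', (wy j' < wx j)%N).
Local Notation K := {fraction {poly F}}.
Local Notation specializes := (specializes (horner_eval (0 : F))).
Local Notation eps := (eps F).

(** The scaled column is the one before [r]. The free factor [eta] serves to avoid the coincidences
    [A c d = 1] between poles. *)
Definition perturb (j : 'I_n) : F := if j == shiftI r n.-1 then eta else 1.
Definition base_x (j : 'I_n) : K := eps ^- wx j.
Definition base_y (j : 'I_n) : K := cst (perturb j) * eps ^- wy j.
Local Notation x := base_x.
Local Notation y := base_y.
Let n0 := n_gt0 r.

Lemma perturb_neq0 j : perturb j != 0.
Proof. by rewrite /perturb; case: ifP => // _; exact: oner_neq0. Qed.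

Lemma base_x_neq0 j : x j != 0.
Proof. by rewrite invr_eq0 expf_neq0 // eps_neq0. Qed.

Lemma base_y_neq0 j : y j != 0.
Proof. by rewrite mulf_neq0 ?fmorph_eq0 ?perturb_neq0 // invr_eq0 expf_neq0 // eps_neq0. Qed.

Lemma specializes_base_ratio j j' : specializes (y j' / x j) 0.
Proof.
have e0 := eps_neq0 F.
have -> : y j' / x j = cst (perturb j') * (eps ^+ (wx j - wy j').-1 * eps).
  rewrite -exprSr prednK ?subn_gt0 // /base_x /base_y invrK -mulrA; congr (_ * _).
  by apply: (mulIf (expf_neq0 (wy j') e0)); rewrite mulrAC mulVf ?expf_neq0 // mul1r -exprD subnK // ltnW.
rewrite -[X in specializes _ X](mulr0 (perturb j')).
apply: specializesM; first exact: specializes_cst.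
rewrite -[X in specializes _ X](mulr0 (0 ^+ (wx j - wy j').-1)).
by apply: specializesM; [apply: specializesX|]; exact: specializes_eps.
Qed.

(** Up to the factor [x r], [increment i] is a product of [i] ratios of an entry of [y] to an entry
    of [x], and each ratio tends to 0. *)
Lemma specializes_increment i :
  specializes (x r * increment r x y i) (if i == 0%N then 1 else 0).
Proof.
case: i => [|i].
  have := increment0 r y base_x_neq0; rewrite shiftI0 => ->; exact: specializes1.
have e : x r * increment r x y i.+1 = \prod_(0 <= l < i.+1) (y (shiftI r l) / x (shiftI r l.+1)).
  rewrite big_split /= prodfV /increment [X in _ / X]big_nat_recl // shiftI0.
  by rewrite invfM mulrCA mulVKf ?base_x_neq0.
rewrite e big_nat_recl // -[X in specializes _ X](mul0r (\prod_(0 <= l < i) 0)).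
apply: specializesM; first exact: specializes_base_ratio.
by apply: specializes_prod => l _; exact: specializes_base_ratio.
Qed.

Lemma specializes_node i : (0 < i)%N -> specializes (x r * node r x y i) 1.
Proof.
case: i => // i _; rewrite /node big_nat_recl // mulrDr mulr_sumr -[X in specializes _ X]addr0.
apply: specializesD; first exact: (specializes_increment 0).
suff: specializes (\sum_(0 <= l < i) x r * increment r x y l.+1) (\sum_(0 <= l < i) 0).
  by rewrite big1_eq.
by apply: specializes_sum => l _; exact: (specializes_increment l.+1).
Qed.

Lemma base_node_neq0 i : (0 < i <= n)%N -> node r x y i != 0.
Proof.
case/andP => i0 _; have := specializes_neq0 (oner_neq0 _) (specializes_node i0).
by rewrite mulf_eq0 negb_or => /andP[].
Qed.

(** After scaling, all nodes of positive index tend to 1, so the constant part of a pencil of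
    positive index cancels in the limit. *)
Lemma specializes_pencil i t :
  specializes (x r * pencil r x y i (cst t)) (if i == 0%N then 1 else t).
Proof.
have [->|i0] := posnP i; first by rewrite pencil0; exact: specializes_node.
rewrite /pencil mulrDr mulrBr mulrA.
suff: specializes (x r * node r x y n - x r * node r x y i + x r * node r x y i * cst t)
    (1 - 1 + 1 * t) by rewrite subrr add0r mul1r.
apply: specializesD; first by apply: specializesB; exact: specializes_node.
by apply: specializesM; [exact: specializes_node | exact: specializes_cst].
Qed.

Lemma specializes_pencil_ratio i i' t : t != 0 ->
  specializes (pencil r x y i (cst t) / pencil r x y i' (cst t))
    ((if i == 0%N then 1 else t) / (if i' == 0%N then 1 else t)).
Proof.
move=> t0; have e0 (k : nat) : (if k == 0%N then 1 else t) != 0 by case: ifP => // _; exact: oner_neq0.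
have -> : pencil r x y i (cst t) / pencil r x y i' (cst t) =
   (x r * pencil r x y i (cst t)) / (x r * pencil r x y i' (cst t)).
  by rewrite -mulf_div divff ?base_x_neq0 // mul1r.
apply: specializesM; first exact: specializes_pencil.
by apply: specializesV => //; exact: specializes_pencil.
Qed.

Lemma offset_eq0 j : (offset r j == 0%N) = (j == r).
Proof.
apply/eqP/eqP => [e|->]; first by rewrite -(shiftI_offset r j) e shiftI0.
by rewrite -{2}(shiftI0 r) offset_shiftI.
Qed.

(** Coordinate [j] involves the pencils of index [offset r j] and its successor. Their limits can
    differ only when the offset is 0, that is [j = r]: in the limit a single column moves. *)
Lemma specializes_curve_x t j : t != 0 ->
  specializes (eps ^+ wx j * curve_x r x y (cst t) j) (if j == r then t else 1).
Proof.
move=> t0; rewrite /curve_x /base_x !mulrA divff ?expf_neq0 ?eps_neq0 // mul1r.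
have := specializes_pencil_ratio (offset r j).+1 (offset r j) t0; rewrite offset_eq0 /=.
by case: ifP => _; rewrite ?divr1 ?divff.
Qed.

Lemma specializes_curve_y t j : t != 0 ->
  specializes (eps ^+ wy j * curve_y r x y (cst t) j) (perturb j * if j == r then t^-1 else 1).
Proof.
move=> t0; rewrite /curve_y /base_y.
have -> : eps ^+ wy j * (cst (perturb j) / eps ^+ wy j * pencil r x y (offset r j) (cst t) /
    pencil r x y (offset r j).+1 (cst t)) = cst (perturb j) *
  (pencil r x y (offset r j) (cst t) / pencil r x y (offset r j).+1 (cst t)).
  by rewrite !mulrA [eps ^+ _ * _]mulrC mulfK // expf_neq0 // eps_neq0.
apply: specializesM; first exact: specializes_cst.
have := specializes_pencil_ratio (offset r j) (offset r j).+1 t0; rewrite offset_eq0 /=.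
by case: ifP => _; rewrite ?div1r ?divff.
Qed.

Lemma specializes_ratio_xyV : specializes (ratio_xy x y)^-1 0.
Proof.
rewrite /ratio_xy invf_div -prodfV -big_split /= (bigD1 r) //=.
rewrite -[X in specializes _ X](mul0r (\prod_(j | j != r) 0)).
apply: specializesM; first exact: specializes_base_ratio.
rewrite -big_filter -[X in specializes _ X]big_filter.
by apply: specializes_prod => j _; exact: specializes_base_ratio.
Qed.

End BasePoint.

Lemma cst_natr_inj (F : fieldType) : (forall k : nat, k.+1%:R != 0 :> F) ->
  injective (fun k : nat => cst (k.+1%:R : F)).
Proof.
move=> n0 k l /fmorph_inj; wlog kl : k l / (k <= l)%N => [th|].
  by case/orP: (leq_total k l) => kl e; [|symmetry]; apply: th.
move=> e; apply/eqP; rewrite eqn_leq kl leqNgt; apply/negP => lk.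
by have := n0 (l - k.+1)%N; rewrite subnSK // -subSS natrB // e subrr eqxx.
Qed.

(** * Choice of the perturbation *)

Section Perturbation.
Variables (F : fieldType) (n : nat) (r : 'I_n) (wx wy : 'I_n -> nat).
Hypothesis natr_neq0 : forall k : nat, k.+1%:R != 0 :> F.
Local Notation x := (base_x F wx).
Local Notation y := (@base_y F n r wy).
Let n0 := n_gt0 r.

Lemma node_base_y (eta : F) i : (i <= n)%N -> node r x (y eta) i = node r x (y 1) i.
Proof.
move=> lin; apply: eq_big_nat => l /andP[_ li]; congr (_ / _).
apply: eq_big_nat => k /andP[_ kl]; rewrite /base_y /perturb.
case: eqP => // /(congr1 val); rewrite !val_shiftI => /eqP.
rewrite eqn_modDl !modn_small; lia.
Qed.

(* The nodes do not involve the entry of [y] scaled by [eta], but [ratio_xy] does. *)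
Lemma exists_perturbation : exists2 eta : F, eta != 0 &
  {in poles r x (y eta) &, forall c d, ratio_xy x (y eta) * c * d != 1}.
Proof.
pose A := ratio_xy x (y 1); pose ps := poles r x (y 1).
(* Replacing 1 by [eta] divides [ratio_xy] by [eta], so [eta] only has to avoid the finitely many
   values [A * c * d]. *)
pose Z := \prod_(z <- [seq A * c * d | c <- ps, d <- ps]) ('X - z%:P).
have Z0 : Z != 0 by rewrite monic_neq0 // monic_prod_XsubC.
have [[|k ks] [_ // _ ksZ]] := many_nonroots (cst_natr_inj natr_neq0) 1 Z0.
have := ksZ k (mem_head _ _); set eta : F := _%:R => Zk.
have eta0 : eta != 0 by exact: natr_neq0.
exists eta => // c d.
have -> : poles r x (y eta) = ps.
  apply/eq_in_map => i; rewrite mem_iota => i0.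
  by rewrite /pole !node_base_y //; lia.
move=> cps dps; apply: contraNneq Zk => e; rewrite -[_ == 0]/(root Z _) root_prod_XsubC.
apply/allpairsP; exists (c, d); split=> //=.
have -> : A = ratio_xy x (y eta) * cst eta.
  rewrite /A /ratio_xy.
  have -> : \prod_j y eta j = cst eta * \prod_j y 1 j.
    rewrite [LHS](bigD1 (shiftI r n.-1)) //= [X in _ = _ * X](bigD1 (shiftI r n.-1)) //= mulrA; congr (_ * _).
      by rewrite /base_y /perturb eqxx rmorph1 mul1r.
    by apply: eq_bigr => j jr; rewrite /base_y /perturb (negPf jr).
  by rewrite invfM [(cst eta)^-1 * _]mulrC mulrA mulfVK // fmorph_eq0.
have insert_mul (K : fieldType) (z u v w : K) : z * v * w = 1 -> u = z * u * v * w.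
  by move=> zvw; rewrite -[LHS]mul1r -zvw; ring.
exact: insert_mul e.
Qed.

End Perturbation.

Lemma Cplx_natr_neq0 (k : nat) : k.+1%:R != 0 :> Cplx.
Proof.
have : k.+1%:R != 0 :> complex Rdefinitions.R by rewrite Num.Theory.pnatr_eq0.
exact.
Qed.

(** * Leading exponents of invariants *)

Section LeadingExponents.
Variables (m n i : nat) (i1m : (i.+1 < m)%N) (r : 'I_n) (p : {mpoly Cplx[nvars m n]}).
Hypotheses (p0 : p != 0) (pinv : R_invariant p).
Local Notation K := {fraction {poly Cplx}}.
Local Notation specializes := (specializes (horner_eval (0 : Cplx))).
Let k0 : 'I_m := Ordinal (ltnW i1m).
Let k1 : 'I_m := Ordinal i1m.

Lemma mlead_row_geq : (mlead p (enum_rank (k1, r)) <= mlead p (enum_rank (k0, r)))%N.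
Proof.
have [w [w_decr w_lead]] := mlead_weight p.
pose wx (j : 'I_n) := w (enum_rank (k0, j)); pose wy (j : 'I_n) := w (enum_rank (k1, j)).
have wyx j j' : (wy j' < wx j)%N by apply/w_decr/enum_rank_row => /=.
have [eta eta0 etaP] := @exists_perturbation Cplx n r wx wy Cplx_natr_neq0.
set x := base_x _ _ in etaP; set y := base_y _ _ _ in etaP; set A := ratio_xy x y in etaP.
have x0 : forall j, x j != 0 := base_x_neq0 _ _.
have y0 : forall j, y j != 0 := base_y_neq0 r wy eta0.
have node0 k : (0 < k <= n)%N -> node r x y k != 0 by exact: (base_node_neq0 r eta wyx).
pose D : {poly K} := 'X * \prod_(c <- poles r x y) ('X - c%:P).
pose pt (t : K) := rows_point i (curve_x r x y t) (curve_y r x y t) (fun a => eps Cplx ^- w (enum_rank a)).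
pose g t := mmap (@cst Cplx) (pt t \o enum_val) p.
have [b [Q gQ]] : exists b (Q : {poly K}), forall t, D.[t] != 0 -> D.[t] ^+ b * g t = Q.[t].
  apply: mmap_common_denominator => v.
  have [Qx DQx] := curve_x_poly node0 (enum_val v).2.
  have [Qy DQy] := curve_y_poly node0 (enum_val v).2.
  pose Qc := (eps Cplx ^- w (enum_rank (enum_val v)))%:P * D.
  exists (if (enum_val v).1 == i :> nat then Qx else if (enum_val v).1 == i.+1 :> nat then Qy else Qc).
  move=> t Dt; rewrite /pt /rows_point /=; case: ifP => _; first exact: DQx.
  case: ifP => _; first exact: DQy.
  by rewrite [in RHS]hornerM hornerC mulrC.
have [Z [Z0 ZP]] := generic_nonroots x0 y0 node0.
(* For generic [t], R carries the point at [t] to the point at [1 / (A t)], and [p] takes the same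
   value at both. *)
have gg t : Z.[t] != 0 -> g t = g (A * t)^-1.
  move=> /ZP[t0 tt pt0 pt'0]; rewrite /g /pt.
  have kap j := curve_kappa_neq0 x0 y0 t0 tt pt0 pt'0 j.
  rewrite -[LHS](specialize_Ri_invariant i1m (@cst Cplx) _ kap pinv).
  apply: eq_mmap => v; rewrite /= /rows_point.
  case: ifP => _; first exact: (curve_Rmat_y' x0 y0 t0 tt pt0 pt'0).
  by case: ifP => _; first exact: (curve_Rmat_x' x0 y0 t0 tt pt0 pt'0).
have A0 : A != 0 := ratio_xy_neq0 x0 y0.
pose M := mlead p; pose M0 := M (enum_rank (k0, r)); pose M1 := M (enum_rank (k1, r)).
have [a [N [M1a gN symN]]] :=
  reflect_invariant_laurent (cst_natr_inj Cplx_natr_neq0) A0 etaP Z0 gQ gg M1.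
rewrite -/M -/M0 -/M1 leqNgt; apply/negP => lt01.
(* [val1 t] is the value at [eps = 0] of the point rescaled by the weights. *)
pose val1 (t : Cplx) : 'I_m * 'I_n -> Cplx := rows_point i (fun j => if j == r then t else 1)
  (fun j => perturb r eta j * (if j == r then t^-1 else 1)) (fun=> 1).
have val1P t v : t != 0 -> specializes (eps Cplx ^+ w v * pt (cst t) (enum_val v)) (val1 t (enum_val v)).
  move=> t0; rewrite /pt /val1 /rows_point; case: ifP => [/eqP vi|vi].
    have -> : w v = wx (enum_val v).2.
      congr w; rewrite -[LHS]enum_valK; congr enum_rank; rewrite [LHS]surjective_pairing.
      by congr (_, _); apply: val_inj.
    exact: (specializes_curve_x r eta wyx).
  case: ifP => [/eqP vi1|vi1].
    have -> : w v = wy (enum_val v).2.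
      congr w; rewrite -[LHS]enum_valK; congr enum_rank; rewrite [LHS]surjective_pairing.
      by congr (_, _); apply: val_inj.
    exact: (specializes_curve_y r eta wyx).
  by rewrite enum_valK mulfV ?expf_neq0 ?eps_neq0 //; exact: specializes1.
pose W := (\sum_v M v * w v)%N.
(* After scaling by [eps ^+ W] the leading monomial has a finite limit; every other monomial of [p]
   has smaller weight and keeps a factor [eps]. *)
have leadP t : t != 0 -> specializes (eps Cplx ^+ W * g (cst t))
    (p@_M * \prod_v val1 t (enum_val v) ^+ M v).
  move=> t0; rewrite /g /mmap mulr_sumr.
  have -> : p@_M * \prod_v val1 t (enum_val v) ^+ M v = \sum_(m0 <- msupp p)
      (if m0 == M then p@_m0 * \prod_v val1 t (enum_val v) ^+ m0 v else 0).
    rewrite -big_mkcond (big_rem M) ?mlead_supp //= eqxx.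
    rewrite [X in _ = _ + X]big_seq_cond [X in _ = _ + X]big1 ?addr0 // => m0; rewrite mem_rem_uniq ?msupp_uniq // inE.
    by case/andP => /andP[/negPf->].
  apply: specializes_sum => m0 m0p.
  have WmE : \prod_v (eps Cplx ^+ w v * pt (cst t) (enum_val v)) ^+ m0 v =
      eps Cplx ^+ (\sum_v m0 v * w v) * mmap1 (pt (cst t) \o enum_val) m0.
    rewrite -prodrXr /mmap1 -big_split /=; apply: eq_bigr => v _.
    by rewrite exprMn -exprM mulnC.
  have prodP : specializes (\prod_v (eps Cplx ^+ w v * pt (cst t) (enum_val v)) ^+ m0 v)
      (\prod_v val1 t (enum_val v) ^+ m0 v).
    by apply: specializes_prod => v _; apply: specializesX; exact: val1P.
  rewrite WmE in prodP.
  case: eqP => [m0M|/eqP m0M].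
    rewrite /W -m0M mulrCA; apply: specializesM; [exact: specializes_cst | exact: prodP].
  have lt := w_lead _ m0p m0M.
  pose k := (W - \sum_v m0 v * w v).-1.
  have -> : W = (k.+1 + \sum_v m0 v * w v)%N by rewrite prednK ?subn_gt0 // subnK // ltnW.
  have -> : eps Cplx ^+ (k.+1 + \sum_v m0 v * w v) *
      (cst p@_m0 * mmap1 (pt (cst t) \o enum_val) m0) =
    eps Cplx * (eps Cplx ^+ k * (cst p@_m0 *
      (eps Cplx ^+ (\sum_v m0 v * w v) * mmap1 (pt (cst t) \o enum_val) m0))).
    by rewrite exprD exprS -!mulrA; congr (_ * (_ * _)); rewrite mulrCA.
  rewrite -[X in specializes _ X](mul0r (0 ^+ k * (p@_m0 * \prod_v val1 t (enum_val v) ^+ m0 v))).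
  apply: specializesM; first exact: specializes_eps.
  apply: specializesM; first exact: (specializesX _ (specializes_eps _)).
  by apply: specializesM; first exact: specializes_cst.
(* Only the entries of the two rows in column [r] depend on [t], through [t] and [t^-1]. *)
have val1E t : t != 0 -> \prod_v val1 t (enum_val v) ^+ M v =
    (\prod_v val1 1 (enum_val v) ^+ M v) * t ^+ M0 / t ^+ M1.
  move=> t0; have single (v0 : 'I_(nvars m n)) (z : Cplx) :
      \prod_v (if v == v0 then z else 1) ^+ M v = z ^+ M v0.
    rewrite (bigD1 v0) //= eqxx big1 ?mulr1 // => v /negPf->; exact: expr1n.
  rewrite -(single (enum_rank (k0, r))) -exprVn -(single (enum_rank (k1, r))) -!big_split /=.
  apply: eq_bigr => v _; rewrite -!exprMn; congr (_ ^+ _).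
  rewrite -!(can_eq (@enum_valK _)) !enum_rankK /val1 /rows_point.
  case: (enum_val v) => k j /=; rewrite !xpair_eqE -!val_eqE /=.
  have [ki|ki] := eqVneq (nat_of_ord k) i.
    by rewrite ki (ltn_eqF (ltnSn i)) /= mulr1 if_same mul1r.
  by rewrite mulr1; case: eqVneq => _ /=; rewrite ?invr1 ?if_same mulr1.
have Cst0 : p@_M * \prod_v val1 1 (enum_val v) ^+ M v != 0.
  rewrite mulf_neq0 ?mleadc_eq0 //; apply/prodf_neq0 => v _; apply: expf_neq0.
  rewrite /val1 /rows_point; case: ifP => _; first by case: ifP => _; exact: oner_neq0.
  case: ifP => _; last exact: oner_neq0.
  by rewrite invr1 if_same mulr1 perturb_neq0.
set Cst := _ * _ in Cst0.
(* Enough interpolation nodes for both [N] and the limit polynomial [P] below. *)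
pose s := (size N + a + M0).+1.
have D0 : D != 0 by rewrite mulf_neq0 ?polyX_eq0 // monic_neq0 // monic_prod_XsubC.
have [ks [uks sks ksD]] := many_nonroots (cst_natr_inj Cplx_natr_neq0) s D0.
pose ts : seq Cplx := [seq k.+1%:R | k <- ks].
have uts : uniq ts.
  rewrite map_inj_uniq // => k l e; apply: (cst_natr_inj Cplx_natr_neq0).
  by rewrite e.
have sts : size ts = s by rewrite size_map.
(* The subtraction is exact, because [M1 <= a]. *)
pose P : {poly Cplx} := Cst *: 'X^(a + M0 - M1).
have coefP := specializes_coef (N := eps Cplx ^+ W *: N) (P := P) uts.
have {coefP} coefP k : specializes (eps Cplx ^+ W *: N)`_k P`_k.
  apply: coefP.
  - by rewrite sts (leq_trans (size_scale_leq _ _)) // /s leqW // -addnA leq_addr.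
  - rewrite sts (leq_trans (size_scale_leq _ _)) // size_polyXn /s ltnS.
    by rewrite (leq_trans (leq_subr _ _)) // -addnA leq_addl.
  move=> _ /mapP[l lks ->]; set t : Cplx := _%:R.
  have t0 : t != 0 by exact: Cplx_natr_neq0.
  have Dt : D.[cst t] != 0 by exact: ksD.
  rewrite hornerZ -gN // mulrCA hornerZ hornerXn.
  have -> : Cst * t ^+ (a + M0 - M1) = t ^+ a * (Cst * t ^+ M0 / t ^+ M1).
    rewrite expfB_cond; last by rewrite (negPf t0) /= (leq_trans M1a) ?leq_addr.
    have assoc (L : fieldType) (z1 z2 z3 z4 : L) : z1 * (z2 * z3 / z4) = z2 * (z1 * z3 / z4).
      by ring.
    by rewrite exprD; exact: assoc.
  apply: specializesM; first by rewrite -rmorphXn; exact: specializes_cst.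
  by have := leadP _ t0; rewrite val1E // /Cst !mulrA.
pose d := (M1 - M0)%N.
have d0 : (0 < d)%N by rewrite subn_gt0.
have da : (d <= a)%N by rewrite /d; lia.
(* Of the coefficients of [eps ^+ W *: N], the one at [a - d] tends to [Cst], the one at [a + d] to
   0. By [symN] the former is the latter times [A ^- d], which tends to 0; hence [Cst] would
   vanish. *)
have low := coefP (a - d)%N; have high := coefP (a + d)%N.
rewrite coefZ coefZ coefXn in low.
have e1 : (a - d == a + M0 - M1)%N by rewrite /d; lia.
have e2 : (a + d == a + M0 - M1)%N = false by rewrite /d; lia.
rewrite e1 mulr1 symN // mulrA in low.
rewrite !coefZ coefXn e2 mulr0 in high.
have := specializesM high (specializesX d (specializes_ratio_xyV r eta wyx)).
rewrite mul0r exprVn => /(specializes_inj low) e.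
by rewrite e eqxx in Cst0.
Qed.

End LeadingExponents.

(** * Invariance of the loop elementary symmetric functions *)

Section ShiftedElementary.
Variables (R : comNzRingType) (T : finType).
Implicit Types (X : T -> nat -> R) (l : seq T) (S : {set T}).

(* [X i t] stands for the entry of row [i] whose superscript is shifted by [t]. *)
Fixpoint shifted_elem X l k t : R :=
  match l, k with
  | _, 0 => 1
  | [::], _ => 0
  | i :: l', k'.+1 => shifted_elem X l' k t + X i t * shifted_elem X l' k' t.+1
  end.

Lemma shifted_elem0 X l t : shifted_elem X l 0 t = 1.
Proof. by case: l. Qed.

(** Subsets are split by whether they contain the head of the list. If they do, every other element
    sits one position further, which accounts for [t.+1]. *)
Lemma shifted_elemE X l k t : uniq l ->
  \sum_(S : {set T} | (S \subset l) && (#|S| == k))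
     \prod_(i <- [seq j <- l | j \in S]) X i (t + index i [seq j <- l | j \in S])%N =
  shifted_elem X l k t.
Proof.
elim: l k t => [|x l ih] k t.
  move=> _; have s0 S : (S \subset [::]) = (S == set0).
    by rewrite -subset0; apply: eq_subset_r => z; rewrite !inE.
  case: k => [|k] /=; last first.
    by rewrite big1 // => S; rewrite s0 => /andP[/eqP->]; rewrite cards0.
  rewrite (big_pred1 set0) ?big_nil // => S.
  by rewrite s0 andb_idr // => /eqP->; rewrite cards0.
move=> /= /andP[xl ul].
have sub_out S : x \notin S -> (S \subset x :: l) = (S \subset l).
  move=> xS; apply/subsetP/subsetP => h z zS; last by rewrite inE h ?orbT.
  by have := h z zS; rewrite inE => /orP[/eqP zx|//]; rewrite zx (negPf xS) in zS.
rewrite (bigID (fun S : {set T} => x \in S)) /= addrC.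
have -> : \sum_(S : {set T} | (S \subset x :: l) && (#|S| == k) && (x \notin S))
     \prod_(i <- (if x \in S then x :: [seq j <- l | j \in S] else [seq j <- l | j \in S]))
       X i (t + index i (if x \in S then x :: [seq j <- l | j \in S] else [seq j <- l | j \in S]))%N =
   shifted_elem X l k t.
  rewrite -ih //; apply: eq_big => [S|S /andP[_ /negPf-> //]].
  case: (boolP (x \in S)) => xS; rewrite ?andbT ?andbF ?sub_out //.
  by apply/esym/negP => /andP[/subsetP/(_ x xS)]; rewrite (negPf xl).
case: k => [|k].
  rewrite shifted_elem0 big1 ?addr0 // => S /andP[/andP[_]].
  by rewrite cards_eq0 => /eqP->; rewrite inE.
congr (_ + _); rewrite -ih // mulr_sumr.
rewrite (reindex_onto (fun S : {set T} => x |: S) (fun S : {set T} => S :\ x)); last first.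
  by move=> S /andP[_ xS]; rewrite setD1K.
apply: eq_big => [S|S].
  rewrite setU11 andbT; case: (boolP (x \in S)) => xS.
    rewrite (_ : _ :\ x == S = false) ?andbF; last first.
      by apply/negP => /eqP e; move: xS; rewrite -e !inE eqxx.
    by apply/esym/negP => /andP[/subsetP/(_ x xS)]; rewrite (negPf xl).
  rewrite setU1K // eqxx andbT cardsU1 xS add1n eqSS; congr (_ && _).
  apply/subsetP/subsetP => h z; last by rewrite in_setU1 inE => /orP[->//|/h->]; rewrite orbT.
  move=> zS; have := h z (setU1r _ zS); rewrite inE => /orP[/eqP zx|//].
  by rewrite zx (negPf xS) in zS.
move=> /andP[/andP[/andP[_ _] _] /eqP eS].
have xS : x \notin S by rewrite -eS !inE eqxx.
rewrite setU11 big_cons /= eqxx addn0; congr (_ * _).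
have -> : [seq j <- l | j \in x |: S] = [seq j <- l | j \in S].
  apply: eq_in_filter => z zl; rewrite !inE; case: eqP => // zx.
  by rewrite zx (negPf xl) in zl.
rewrite big_seq [RHS]big_seq; apply: eq_bigr => z; rewrite mem_filter => /andP[_ zl].
case: eqP => [xz|_]; first by rewrite xz zl in xl.
by rewrite addnS.
Qed.

Lemma eq_shifted_elem X X' l k t : {in l, forall i, X i =1 X' i} ->
  shifted_elem X l k t = shifted_elem X' l k t.
Proof.
elim: l k t => [|i l ih] [|k] t //= e; rewrite e ?mem_head //.
by rewrite !ih // => j jl; apply: e; rewrite inE jl orbT.
Qed.

(** Expanded in two adjacent rows, the function involves them only through [X i s + X j s] and
    [X i s * X j s.+1]. *)
Lemma shifted_elem_swap X X' l1 i j l2 k t :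
  {in l1 ++ l2, forall a, X a =1 X' a} ->
  (forall s, X i s + X j s = X' i s + X' j s) ->
  (forall s, X i s * X j s.+1 = X' i s * X' j s.+1) ->
  shifted_elem X (l1 ++ [:: i, j & l2]) k t = shifted_elem X' (l1 ++ [:: i, j & l2]) k t.
Proof.
move=> e eD eM; elim: l1 k t e => [|a l1 ih] k t e.
  have e2 k' t' : shifted_elem X l2 k' t' = shifted_elem X' l2 k' t' by exact: eq_shifted_elem.
  case: k => [|[|k]] //=.
    rewrite !shifted_elem0 !mulr1 !e2 -!addrA; congr (_ + _).
    by rewrite addrC eD addrC.
  rewrite !e2 !mulrDr !mulrA eM.
  have := eD t => /eqP; rewrite -subr_eq0 => /eqP eDt.
  apply/eqP; rewrite -subr_eq0 -[X in _ == X](mul0r (shifted_elem X' l2 k.+1 t.+1)) -[X in _ == X * _]eDt.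
  by apply/eqP; ring.
case: k => [|k] //=.
rewrite !ih ?e ?mem_head // => b bl; apply: e; by rewrite inE bl orbT.
Qed.

End ShiftedElementary.

(** * Conservation laws of the R-matrix *)

Section RmatIdentities.
Variables (F : fieldType) (n : nat) (x y : 'I_n -> F).
Hypothesis kap0 : forall j, kappa x y j != 0.

(** The right-hand side of [kappa_rec] does not depend on the column; comparing it at [j] and at the
    next column gives the identity. *)
Lemma Rmat_sum j : Rmat_y' x y (shiftI j 1) + Rmat_x' x y j = x (shiftI j 1) + y j.
Proof.
rewrite /Rmat_y' /Rmat_x' -mulrDl; apply: (mulIf (kap0 (shiftI j 1))); rewrite mulfVK //.
have e1 := kappa_rec x y (shiftI j 1); have e2 := kappa_rec x y j; rewrite -e2 in e1.
move/eqP: e1; rewrite -subr_eq0 => /eqP e1.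
by apply/eqP; rewrite -subr_eq0 -[X in _ == X]e1; apply/eqP; ring.
Qed.

Lemma Rmat_prod j : Rmat_y' x y j * Rmat_x' x y j = x j * y j.
Proof. by rewrite /Rmat_y' /Rmat_x'; field; rewrite !kap0. Qed.

End RmatIdentities.

Section LoopInvariance.
Variables (m n : nat).

Lemma shiftI_mod (r : 'I_n) s t : s = t %[mod n] -> shiftI r s = shiftI r t.
Proof. by move=> st; apply: val_inj; rewrite !val_shiftI -modnDmr st modnDmr. Qed.

(* The column of the variable x_{i+1}^{(r+t)} in the coordinates x_i^j. *)
Definition loop_column (r : 'I_n) (i t : nat) : 'I_n := shiftI r (t + (n - i %% n)).

(** Hence the entries multiplied in [shifted_elem_swap] lie in one column and those added in
    neighbouring columns, as in the conservation laws of R. The case split is on the wrap-around of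
    [i] modulo [n]. *)
Lemma loop_columnS r i t : loop_column r i.+1 t.+1 = loop_column r i t.
Proof.
have n0 := n_gt0 r; apply: shiftI_mod.
have lt := ltn_pmod i n0.
have [e|ne] := eqVneq (i %% n).+1 n.
  have -> : (i.+1 %% n = 0)%N by rewrite -addn1 -modnDml addn1 e modnn.
  by rewrite (_ : t.+1 + (n - 0) = t + (n - i %% n) + n)%N ?modnDr //; lia.
have -> : (i.+1 %% n = (i %% n).+1)%N.
  by rewrite -addn1 -modnDml addn1 modn_small // ltn_neqAle ne.
by congr (_ %% _)%N; lia.
Qed.

Lemma loop_column_shift r i t : shiftI (loop_column r i t) 1 = loop_column r i t.+1.
Proof. by rewrite /loop_column shiftID addn1. Qed.

Lemma enum_filter (T : finType) (S : {set T}) : enum S = [seq j <- enum T | j \in S].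
Proof. by rewrite enumT. Qed.

Lemma xloopE (i : 'I_m) (r : 'I_n) t : xloop i (shiftI r t) = xv i (loop_column r i t).
Proof. by rewrite /loop_column -shiftID. Qed.

Lemma mmap_loop_e (R : comNzRingType) (f : {rmorphism Cplx -> R}) h k (r : 'I_n) :
  mmap f h (loop_e m k r) =
  shifted_elem (fun (i : 'I_m) t => h (enum_rank (i, loop_column r i t))) (enum 'I_m) k 0.
Proof.
rewrite -shifted_elemE ?enum_uniq // /loop_e rmorph_sum /=.
apply: eq_big => [S|S _].
  by rewrite (_ : S \subset enum 'I_m) //; apply/subsetP => z _; rewrite mem_enum.
rewrite rmorph_prod -enum_filter; apply: eq_bigr => i _.
by rewrite xloopE /xv /= mmapX mmap1U.
Qed.

Lemma tofrac_mmap (p : {mpoly Cplx[nvars m n]}) :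
  frac_of p = mmap (@frac_cst m n) (fun v => frac_of 'X_v) p.
Proof.
rewrite /frac_of; elim/mpoly_ring_ind: p => [c|v|p q hp hq|p q hp hq].
- by rewrite mmapC.
- by rewrite mmapX mmap1U.
- by rewrite tofracD mmapD hp hq.
- by rewrite tofracM rmorphM hp hq.
Qed.

(** Setting every variable to 1 turns [kappa] into [n], nonzero in characteristic 0. *)
Lemma kappa_xf_neq0 (k0 k1 : 'I_m) (j : 'I_n) : kappa (@xf m n k0) (xf k1) j != 0.
Proof.
have -> : kappa (@xf m n k0) (xf k1) j = frac_of (kappa (xv k0) (xv k1) j).
  by rewrite /frac_of rmorph_kappa.
rewrite tofrac_eq0; pose ev : {rmorphism _ -> _} := @mmap (nvars m n) Cplx Cplx idfun (fun=> 1).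
apply/eqP => /(congr1 ev); rewrite rmorph0 rmorph_kappa => /eqP.
have -> : kappa (ev \o xv k0) (ev \o xv k1) j = n%:R.
  rewrite -[n in n%:R]card_ord -sumr_const; apply: eq_bigr => k _.
  by rewrite !big1 ?mulr1 // => t _; rewrite /ev /= mmapX mmap1U.
have n0 := n_gt0 j; rewrite -(prednK n0); apply/negP; exact: Cplx_natr_neq0.
Qed.

Lemma Ri_act_loop_e i k (r : 'I_n) : (i.+1 < m)%N ->
  Ri_act i (loop_e m k r) = frac_of (loop_e m k r).
Proof.
move=> i1m; rewrite Ri_actE tofrac_mmap !mmap_loop_e.
pose k0 : 'I_m := Ordinal (ltnW i1m); pose k1 : 'I_m := Ordinal i1m.
have kap0 j := kappa_xf_neq0 k0 k1 j.
have [l1 [l2 enumE]] : exists l1 l2, enum 'I_m = l1 ++ [:: k0, k1 & l2].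
  exists (take i (enum 'I_m)), (drop i.+2 (enum 'I_m)).
  rewrite -{1}(cat_take_drop i (enum 'I_m)); congr (_ ++ _).
  rewrite (drop_nth k0) ?size_enum_ord 1?ltnW // (nth_ord_enum k0 k0); congr (_ :: _).
  by rewrite (drop_nth k0) ?size_enum_ord // (nth_ord_enum k0 k1).
have k0E : insubd k0 i = k0 by apply: val_inj; rewrite val_insubd ltnW.
have subst0 j : Ri_subst i (k0, j) = Rmat_y' (@xf m n k0) (xf k1) j.
  rewrite /Ri_subst /= eqxx k0E; congr (Rmat_y' _ (xf _) _).
  by apply: val_inj; rewrite val_insubd i1m.
have subst1 j : Ri_subst i (k1, j) = Rmat_x' (@xf m n k0) (xf k1) j.
  rewrite /Ri_subst /= eqxx gtn_eqF // (_ : insubd k1 i = k0); last first.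
    by apply: val_inj; rewrite val_insubd ltnW.
  by congr (Rmat_x' _ (xf _) _); apply: val_inj; rewrite val_insubd i1m.
rewrite enumE; apply: shifted_elem_swap => [a|s|s].
- have := enum_uniq 'I_m; rewrite enumE uniq_catC cat_cons [_ ++ _]cat_cons !cons_uniq.
  rewrite inE negb_or => /and3P[/andP[_ nk0] nk1 _]; rewrite mem_cat orbC -mem_cat => al t.
  rewrite enum_rankK /Ri_subst /=.
  rewrite !ifF //; apply/negbTE/eqP => e.
    have ak : a = k1 by apply: val_inj.
    by rewrite ak (negPf nk1) in al.
  have ak : a = k0 by apply: val_inj.
  by rewrite ak (negPf nk0) in al.
- rewrite !enum_rankK subst0 subst1 -[loop_column r k0 s](loop_columnS r i) -loop_column_shift.
  exact: Rmat_sum.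
- rewrite !enum_rankK subst0 subst1 (loop_columnS r i); exact: Rmat_prod.
Qed.

End LoopInvariance.

(** * Leading monomials of the loop elementary symmetric functions *)

Section LeadingMonomial.
Variables (m n : nat) (r : 'I_n).

Definition loop_mono (S : {set 'I_m}) : 'X_{1..nvars m n} :=
  (\sum_(i <- enum S) U_(enum_rank (i, loop_column r i (index i (enum S)))))%MM.

Lemma loop_eE k : loop_e m k r = \sum_(S : {set 'I_m} | #|S| == k) 'X_[loop_mono S].
Proof.
apply: eq_bigr => S _; rewrite /loop_mono -mprodXE; apply: eq_bigr => i _.
by rewrite xloopE.
Qed.

Lemma mdeg_loop_mono S : mdeg (loop_mono S) = #|S|.
Proof.
rewrite mdeg_sum (eq_bigr (fun=> 1%N)) => [|i _]; last exact: mdeg1.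
by rewrite sum1_size -cardE.
Qed.

Lemma loop_monoE S a j :
  loop_mono S (enum_rank (a, j)) = (a \in S) && (loop_column r a (index a (enum S)) == j).
Proof.
rewrite mnm_sumE (eq_bigr (fun i => ((i == a) && (loop_column r i (index i (enum S)) == j) : nat))); last first.
  by move=> i _; rewrite mnm1E (can_eq (@enum_rankK _)) xpair_eqE.
case: (boolP (a \in S)) => aS /=.
  rewrite (bigD1_seq a) ?mem_enum ?enum_uniq //= eqxx /= big1 ?addn0 // => i.
  by move=> /negPf->.
rewrite big_seq big1 // => i; rewrite mem_enum => iS.
by case: eqP => // ia; rewrite ia (negPf aS) in iS.
Qed.

(** No row before [a] is missing, so nothing shifts the position of [a]. With [loop_column_diag]
    this puts the variable of row [a] in column [r]. *)
Lemma index_enum_initial (S : {set 'I_m}) (a : 'I_m) :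
  a \in S -> (forall b : 'I_m, (b < a)%N -> b \in S) -> index a (enum S) = a.
Proof.
move=> aS lS; rewrite enum_filter -(cat_take_drop a (enum 'I_m)) filter_cat.
have am : (a < size (enum 'I_m))%N by rewrite size_enum_ord.
have tS : all (mem S) (take a (enum 'I_m)).
  apply/(all_nthP a) => k; rewrite size_takel ?(ltnW am) // => ka; rewrite nth_take //.
  by apply: lS; rewrite nth_enum_ord // (ltn_trans ka).
rewrite (all_filterP tS) index_cat ifN; last first.
  apply/negP => /(nthP a)[k]; rewrite size_takel ?(ltnW am) // => ka.
  rewrite nth_take // => /(congr1 val) /=; rewrite nth_enum_ord ?(ltn_trans ka) // => e.
  by rewrite e ltnn in ka.
rewrite (drop_nth a am) nth_ord_enum /= aS /= eqxx addn0 size_takel //; exact: ltnW.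
Qed.

Lemma loop_column_diag i : loop_column r i i = r.
Proof.
have n0 := n_gt0 r; rewrite -[RHS]shiftI0; apply: shiftI_mod.
rewrite mod0n {1}(divn_eq i n) -addnA subnKC ?modnMDl ?modnn //.
exact: ltnW (ltn_pmod _ n0).
Qed.

Definition initial_rows (k : nat) : {set 'I_m} := [set i : 'I_m | (i <= k)%N].

Lemma card_initial_rows (k : 'I_m) : #|initial_rows k| = k.+1.
Proof.
rewrite -sum1_card (eq_bigl (fun i : 'I_m => (i < k.+1)%N)) => [|i]; last by rewrite inE.
by rewrite -(big_ord_widen m (fun=> 1%N)) // sum1_card card_ord.
Qed.

Lemma initial_mono k a j :
  loop_mono (initial_rows k) (enum_rank (a, j)) = (a <= k)%N && (j == r).
Proof.
rewrite loop_monoE inE; case: leqP => //= ak.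
rewrite index_enum_initial ?inE //; first by rewrite loop_column_diag eq_sym.
by move=> b ba; rewrite inE (leq_trans (ltnW ba)).
Qed.

(** The comparison is made at the first row [t <= k] missing from [S], which exists because both
    sets have [k.+1] elements. Before the variable [(t, r)] the exponents agree; there they are 0
    and 1. *)
Lemma loop_mono_lt (k : 'I_m) (S : {set 'I_m}) : #|S| = k.+1 -> S != initial_rows k ->
  (loop_mono S < loop_mono (initial_rows k))%O.
Proof.
move=> cS SI.
have [a0 a0I] : exists a, (a \in initial_rows k) && (a \notin S).
  apply/existsP; rewrite -[X in is_true X]negbK; apply: contra SI; rewrite negb_exists => /forallP h.
  rewrite eq_sym eqEcard cS card_initial_rows leqnn andbT; apply/subsetP => a aI.
  by have := h a; rewrite aI /= negbK.
case: (@arg_minnP _ a0 [pred a | (a \in initial_rows k) && (a \notin S)] (@nat_of_ord m) a0I) => /= t /andP[tI tS] tmin.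
rewrite inE in tI.
have below (b : 'I_m) : (b < t)%N -> b \in S.
  move=> bt; apply/negPn/negP => bS; have := tmin b; rewrite inE bS andbT (leq_trans (ltnW bt)) //.
  by move=> /(_ isT); rewrite leqNgt bt.
apply/ltmcP; first by rewrite !mdeg_loop_mono cS card_initial_rows.
exists (enum_rank (t, r)); last by rewrite initial_mono loop_monoE (negPf tS) tI eqxx.
move=> v; rewrite -(enum_valK v); case: (enum_val v) => b j vlt.
have bt : (b <= t)%N by rewrite leqNgt; apply: contraL vlt => /(@enum_rank_row _ _ (t, r) (b, j)) lt; rewrite -leqNgt ltnW.
rewrite initial_mono (leq_trans bt tI) loop_monoE /=.
move: bt; rewrite leq_eqVlt => /orP[/eqP bt|bt].
  have bt' : b = t by apply: val_inj.
  rewrite bt' (negPf tS) /=; case: eqP => // jr.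
  by rewrite bt' jr ltnn in vlt.
rewrite below // index_enum_initial ?below // => [|c cb]; last by rewrite below // (ltn_trans cb).
by rewrite loop_column_diag eq_sym.
Qed.

Lemma mlead_loop_e (k : 'I_m) : mlead (loop_e m k.+1 r) = loop_mono (initial_rows k).
Proof.
rewrite loop_eE (bigD1 (initial_rows k)) /=; last by rewrite card_initial_rows.
rewrite mleadDl mleadXm //.
elim/big_ind: _ => [|p q hp hq|S /andP[/eqP cS SI]].
- by rewrite mlead0; apply: lt_mdeg_ltmc; rewrite mdeg0 mdeg_loop_mono card_initial_rows.
- by apply: (le_lt_trans (mleadD_le _ _)); rewrite ltUx hp hq.
- by rewrite mleadXm; exact: loop_mono_lt.
Qed.

Lemma loop_e_neq0 (k : 'I_m) : loop_e m k.+1 r != 0.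
Proof.
apply/eqP => e; have := card_initial_rows k.
by rewrite -mdeg_loop_mono -mlead_loop_e e mlead0 mdeg0.
Qed.

End LeadingMonomial.

(** * Reduction of invariants by their leading monomials *)

Section LoopAlgebra.
Variables (m n : nat).
Implicit Types (p q : {mpoly Cplx[nvars m n]}) (d : 'X_{1..nvars m n}).

Definition loop_gen (v : 'I_(nvars m n)) : {mpoly Cplx[nvars m n]} :=
  loop_e m (enum_val v).1.+1 (enum_val v).2.

Definition loop_subst q : {mpoly Cplx[nvars m n]} :=
  mmap (@mpolyC (nvars m n) Cplx) loop_gen q.

Lemma loop_substD p q : loop_subst (p + q) = loop_subst p + loop_subst q.
Proof. exact: mmapD. Qed.

Lemma loop_substM p q : loop_subst (p * q) = loop_subst p * loop_subst q.
Proof. exact: rmorphM. Qed.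

Lemma frac_ofD p q : frac_of (p + q) = frac_of p + frac_of q.
Proof. exact: tofracD. Qed.

Lemma frac_ofB p q : frac_of (p - q) = frac_of p - frac_of q.
Proof. exact: tofracB. Qed.

Lemma frac_ofM p q : frac_of (p * q) = frac_of p * frac_of q.
Proof. exact: tofracM. Qed.

Lemma Ri_actB i p q : Ri_act i (p - q) = Ri_act i p - Ri_act i q.
Proof. by rewrite !Ri_actE mmapB. Qed.

Lemma Ri_actD i p q : Ri_act i (p + q) = Ri_act i p + Ri_act i q.
Proof. by rewrite !Ri_actE mmapD. Qed.

Lemma Ri_actM i p q : Ri_act i (p * q) = Ri_act i p * Ri_act i q.
Proof. by rewrite !Ri_actE rmorphM. Qed.

Lemma loop_subst_invariant q : R_invariant (loop_subst q).
Proof.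
move=> i i1m; elim/mpoly_ring_ind: q => [c|v|p q hp hq|p q hp hq].
- by rewrite /loop_subst Ri_actE !mmapC.
- by rewrite /loop_subst mmapX mmap1U Ri_act_loop_e.
- rewrite loop_substD Ri_actD frac_ofD; exact: (congr2 +%R hp hq).
- rewrite loop_substM Ri_actM frac_ofM; exact: (congr2 *%R hp hq).
Qed.

Lemma mlead_loop_subst d v :
  mlead (loop_subst 'X_[d]) v = (\sum_u d u * loop_mono (enum_val u).2 (initial_rows m (enum_val u).1) v)%N.
Proof.
rewrite /loop_subst mmapX /mmap1 mlead_prod; last first.
  by move=> u _ _; rewrite expf_neq0 // loop_e_neq0.
rewrite mnm_sumE; apply: eq_bigr => u _.
by rewrite mleadX ?loop_e_neq0 // mlead_loop_e mulmnE mulnC.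
Qed.

Lemma loop_subst_mono_neq0 d : loop_subst 'X_[d] != 0.
Proof.
rewrite /loop_subst mmapX; apply/prodf_neq0 => u _.
by rewrite expf_neq0 // loop_e_neq0.
Qed.

(** Natural subtraction truncates; monotonicity makes each difference exact, so the sum
    telescopes. *)
Lemma sum_decrements (f : nat -> nat) a b : (forall k, (f k.+1 <= f k)%N) -> (a <= b)%N ->
  (\sum_(a <= k < b) (f k - f k.+1) = f a - f b)%N.
Proof.
move=> fd; elim: b => [|b ih]; first by rewrite leqn0 => /eqP->; rewrite big_geq // subnn.
rewrite leq_eqVlt => /orP[/eqP->|]; first by rewrite big_geq // subnn.
rewrite ltnS => ab; rewrite big_nat_recr //= ih //.
have fab : (f b <= f a)%N.
  by elim: b ab {ih} => [|b ih]; [rewrite leqn0 => /eqP-> | rewrite leq_eqVlt => /orP[/eqP->//|/ih]; apply: leq_trans].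
by have := fd b; lia.
Qed.

(** In each column the exponents decrease down the rows, like the parts of a partition. The
    generator with index pair [(k, j)] adds 1 in column [j] to rows 0 to [k], so its exponent is the
    drop from row [k] to row [k.+1]. *)
Lemma mlead_loop_mono p : R_invariant p -> p != 0 ->
  exists d, mlead (loop_subst 'X_[d]) = mlead p.
Proof.
move=> pinv p0; pose M := mlead p.
(* The value 0 past the last row makes the drop there the full exponent. *)
pose f (j : 'I_n) k := if insub k is Some i then M (enum_rank (i : 'I_m, j)) else 0%N.
have fE j (i : 'I_m) : f j i = M (enum_rank (i, j)) by rewrite /f valK.
have fm j k : (m <= k)%N -> f j k = 0%N by rewrite /f leqNgt => mk; rewrite insubN.
have fd j k : (f j k.+1 <= f j k)%N.
  have [k1m|mk] := ltnP k.+1 m; last by rewrite fm.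
  rewrite (fE j (Ordinal k1m)) (fE j (Ordinal (ltnW k1m))).
  exact: mlead_row_geq.
pose d : 'X_{1..nvars m n} := [multinom (f (enum_val v).2 (enum_val v).1 - f (enum_val v).2 (enum_val v).1.+1)%N | v < nvars m n].
exists d; apply/mnmP => v; rewrite mlead_loop_subst.
rewrite -(enum_valK v); case: (enum_val v) => a j.
rewrite (reindex (@enum_rank {: 'I_m * 'I_n})) /=; last by apply: onW_bij; exact: enum_rank_bij.
rewrite (eq_bigr (fun u : 'I_m * 'I_n => ((f u.2 u.1 - f u.2 u.1.+1) * ((a <= u.1) && (j == u.2)))%N)); last first.
  by move=> u _; rewrite mnmE enum_rankK initial_mono.
rewrite -(pair_big xpredT xpredT (fun (k : 'I_m) (l : 'I_n) => ((f l k - f l k.+1) * ((a <= k) && (j == l)))%N)) /=.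
rewrite (eq_bigr (fun k : 'I_m => ((f j k - f j k.+1) * (a <= k))%N)); last first.
  move=> k _; rewrite (bigD1 j) //= eqxx andbT big1 ?addn0 // => l /negPf jl.
  by rewrite eq_sym jl andbF muln0.
rewrite -(big_mkord xpredT (fun k => ((f j k - f j k.+1) * (a <= k))%N)).
rewrite (@big_cat_nat _ _ _ a) //=; last exact: ltnW.
rewrite big_nat_cond big1 ?add0n; last by move=> k /andP[/andP[_ ka] _]; rewrite leqNgt ka muln0.
rewrite (eq_big_nat _ _ (F2 := fun k => (f j k - f j k.+1)%N)); last first.
  by move=> k /andP[ak _]; rewrite ak muln1.
by rewrite sum_decrements ?fd // 1?ltnW // (fm j m) // subn0 fE.
Qed.

Lemma invariant_loop_subst p : R_invariant p -> exists q, p = loop_subst q.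
Proof.
have [M eM] : exists M, mlead p = M by exists (mlead p).
move: M p eM; apply: (@ltmwf (nvars m n)) => M ih p eM pinv.
have [->|p0] := eqVneq p 0; first by exists 0; rewrite /loop_subst mmap0.
have [d dM] := mlead_loop_mono pinv p0; set t := loop_subst 'X_[d] in dM.
have t0 : t != 0 := loop_subst_mono_neq0 d.
pose c := mleadc p / mleadc t; pose p' := p - c *: t.
have cE : c *: t = loop_subst (c *: 'X_[d]) by rewrite /t /loop_subst mmapZ mul_mpolyC.
have p'inv : R_invariant p'.
  move=> i i1m; rewrite /p' cE Ri_actB frac_ofB.
  exact: (congr2 (fun z w => z - w) (pinv i i1m) (loop_subst_invariant _ i1m)).
suff [q qE] : exists q, p' = loop_subst q.
  exists (q + c *: 'X_[d]); by rewrite loop_substD -cE -qE subrK.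
have [p'0|p'0] := eqVneq p' 0; first by exists 0; rewrite /loop_subst mmap0.
(* The leading monomial of [p'] is at most that of [p]; equality is excluded because [c] was chosen
   to cancel the coefficient there. *)
apply: (ih (mlead p')) => //; rewrite -eM lt_neqAle; apply/andP; split; last first.
  apply: le_trans (mleadB_le _ _) _; rewrite leUx lexx /=.
  by apply: le_trans (mleadZ_le _ _) _; rewrite dM.
have tM : t@_(mlead p) = mleadc t by rewrite dM.
have mt0 : mleadc t != 0 by rewrite mleadc_eq0.
by apply: contraNneq p'0 => e; rewrite -mleadc_eq0 e mcoeffB mcoeffZ tM mulfVK // subrr.
Qed.

End LoopAlgebra.

Theorem theorem6p6 (m n : nat) (p : {mpoly Cplx[nvars m n]}) :
  R_invariant p <-> in_loop_sym_algebra p.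
Proof.
split=> [/invariant_loop_subst[q ->]|[q ->]]; first by exists q.
exact: loop_subst_invariant.
Qed.
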